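(* Let $n$ be a positive integer with $n\equiv 2 \pmod 3$, let $c,e$ be indeterminates, and let $M=(n+1)/3$ or $M=n-1$. Then, modulo $[n]\Phi_n(q)^3$, \begin{align*} &\sum_{k=0}^M[6k-1]\frac{\left(q^{-1};q^3\right)^4_k\left(cq^{-1},eq^{-1};q^3\right)_k} {{\left(q^3;q^3\right)^4_k}\left(q^3/c,q^3/e;q^3\right)_k}\left(\frac{q^9}{ce}\right)^k\\ &\equiv[n]q^{(n+1)/3}\frac{\left(q^{-2};q^3\right)_{(n+1)/3}}{\left(q^3;q^3\right)_{(n+1)/3}}\left (1-[n]^2\sum_{i=1}^{(n+1)/3}\frac{q^{3i}}{[3i]^2}\right) \sum_{k=0}^{(n+1)/3}\frac{\left(q^4/(ce);q^3\right)_k\left(q^{-1};q^3\right)^3_k}{\left(q^3/c,q^3/e,q^3,q^{-2};q^3\right)_k}q^{3k}. \end{align*}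
   Context: $q$ is an indeterminate. The $q$-shifted factorial is $(a;q)_0=1$, $(a;q)_m=(1-a)(1-aq)\cdots(1-aq^{m-1})$ for positive integers $m$, and $(a_1,\dots,a_s;q)_m=(a_1;q)_m\cdots(a_s;q)_m$; $(a;q)_m^j$ means $((a;q)_m)^j$. For an integer $m$, $[m]=[m]_q=(1-q^m)/(1-q)$ (so $[m]=1+q+\cdots+q^{m-1}$ for $m\ge1$). $\Phi_n(q)$ is the $n$-th cyclotomic polynomial. For rational functions $A,B$ in $q$ (and the parameters) and a polynomial $P$ in $q$, $A\equiv B \pmod P$ means that $A-B=P\cdot F/G$ with $F,G$ polynomials and $G$ coprime to $P$. *)

(* Defs.v *)
From HB Require Import structures.
From mathcomp Require Import all_boot all_order all_algebra all_field.
Set Implicit Arguments. Unset Strict Implicit. Unset Printing Implicit Defensive.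
Import Order.TTheory GRing.Theory Num.Theory.
Local Open Scope ring_scope.

Definition Kce : fieldType := {fraction {poly {poly rat}}}.
Definition Pq : idomainType := {poly Kce}.
Definition Fq : fieldType := {fraction Pq}.

Definition toF (p : Pq) : Fq := @FracField.tofrac Pq p.
Definition toK (p : {poly {poly rat}}) : Kce := @FracField.tofrac _ p.
Definition q : Fq := toF 'X.
Definition cc : Fq := toF ((toK 'X)%:P).
Definition ee : Fq := toF ((toK ('X : {poly rat})%:P)%:P).

Definition qpoch (a b : Fq) (m : nat) : Fq := \prod_(i < m) (1 - a * b ^+ i).

Definition qint (m : int) : Fq := (1 - q ^ m) / (1 - q).

Definition qintP (n : nat) : Pq := \sum_(i < n) 'X ^+ i.
Definition PhiP (n : nat) : Pq := map_poly (fun z : int => z%:~R) 'Phi_n.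

Definition eqmodq (A B : Fq) (P : Pq) : Prop :=
  exists F G : Pq, G != 0 /\ coprimep G P /\ A - B = toF P * toF F / toF G.

(* Main.v *)
(** Put Q = q^3, a = q^-1 and u = q^n, so that u = a Q^M with M = (n+1)/3.  Write T(x,y,z)
for the well-poised summand in which three of the four parameters a are replaced by
xa, ya, za; the theorem is about T(1,1,1).  When z = 1/u the sum terminates at M and is
given by Watson's transformation of a terminating 8phi7 into a balanced 4phi3.  The
combination T(1,1,1) - T(u,1,1/u) - T(1,1,1/u) + T(u,1/u,1/u) equals (1-u)^3 T(1,1,1) f,
where modulo 1-u the factor f is invariant under k -> M-k while T(1,1,1) changes sign; hence
its sum over k is divisible by (1-u)^4, which gives the congruence modulo Phi_n^4.  For
a divisor d of n with 1 < d < n, both sides vanish modulo Phi_d: on the left the terms of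
each block of d consecutive indices cancel in pairs by the same antisymmetry, on the
right the factor [n] is divisible by Phi_d and the cofactor is Phi_d-integral. *)
Require Import Defs.
From HB Require Import structures.
From mathcomp Require Import all_boot all_order all_algebra all_field.
From mathcomp Require Import ring zify.
From mathcomp Require boolp.
Set Implicit Arguments.
Unset Strict Implicit.
Unset Printing Implicit Defensive.
Import Order.TTheory GRing.Theory Num.Theory.
Local Open Scope ring_scope.

(** The obstacle is that T(1,1,1) contains no parameter Q^-M: it terminates only modulo 1 - u, so
    the terminating form of Watson's transformation does not apply to it. The four terms of the
    combination are T(1,1,1) times 1, 1 + (1-u)^2 xi, 1 + (1-u) eta and the product of the last two,
    so inclusion and exclusion leaves (1-u)^3 xi eta. The pair u, 1/u costs only second order
    because (1 - ux)(1 - x/u) = (1-x)^2 - x(1-u)^2/u. The same identity applied to (Q/u)_M (Qu)_M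
    produces the correction factor with the sum of q^(3i)/[3i]^2. Each of the three evaluated sums
    carries a factor 1 - u, from (a)_(M+1) = (a)_M (1-u), so the rest of the evaluation has to be
    known only modulo (1-u)^3. The modulus [n] Phi_n^3 is Phi_n^4 times the product of the Phi_d
    with d | n, 1 < d < n. Each factor is treated in its own localization, where 1 - q^d stands for
    Phi_d up to a unit, so that every divisibility question concerns binomials 1 - q^m. The local
    statements are glued by coprimality. *)

(** * Shifted factorials with base Q over a field *)

Section QFactorial.
Variables (F : fieldType) (Q : F).

Definition qfac (x : F) (k : nat) : F := \prod_(i < k) (1 - x * Q ^+ i).

Lemma qfac0 x : qfac x 0 = 1. Proof. by rewrite /qfac big_ord0. Qed.

Lemma qfacS x k : qfac x k.+1 = qfac x k * (1 - x * Q ^+ k).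
Proof. by rewrite /qfac big_ord_recr. Qed.

Lemma qfac_shift x k : qfac x k.+1 = (1 - x) * qfac (x * Q) k.
Proof.
rewrite /qfac big_ord_recl expr0 mulr1; congr (_ * _).
by apply: eq_bigr => i _; rewrite exprS mulrA.
Qed.

Lemma qfacD x i j : qfac x (i + j) = qfac x i * qfac (x * Q ^+ i) j.
Proof.
elim: j => [|j IH]; first by rewrite addn0 qfac0 mulr1.
by rewrite addnS !qfacS IH exprD !mulrA.
Qed.

Lemma qfac_neq0 x k : (forall i, (i < k)%N -> 1 - x * Q ^+ i != 0) -> qfac x k != 0.
Proof. by move=> h; apply/prodf_neq0 => i _; apply: h. Qed.

Lemma qfac_eq0 x k i : (i < k)%N -> x * Q ^+ i = 1 -> qfac x k = 0.
Proof. by move=> ik h; rewrite /qfac (bigD1 (Ordinal ik)) //= h subrr mul0r. Qed.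

Hypothesis Q0 : Q != 0.

Lemma qfac_inv_eq0 j k : (k < j)%N -> qfac (Q ^- k) j = 0.
Proof. by move=> kj; apply: (qfac_eq0 kj); rewrite mulVf // expf_neq0. Qed.

End QFactorial.

(** Lower parameters enter the hypotheses as 1 - (t/x) y, while [field] clears the denominator x and
    asks for x - t y. *)
Lemma den_neq0 (F : fieldType) (x t y : F) : x != 0 -> 1 - t / x * y != 0 -> x - t * y != 0.
Proof.
by move=> x0; apply: contraNneq => h; apply/eqP; rewrite mulrAC -(divff x0) -mulrBl h mul0r.
Qed.

(** * The q-Saalschütz sum and Watson's transformation *)

Section Watson.
Variables (F : fieldType) (Q a b c d e f : F) (N : nat).
Local Notation P := (qfac Q).
Hypotheses (Q0 : Q != 0) (a0 : a != 0) (b0 : b != 0) (c0 : c != 0) (d0 : d != 0)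
  (e0 : e != 0) (f0 : f != 0).
Hypothesis Qn1 : forall i, (i < N)%N -> 1 - Q * Q ^+ i != 0.
Hypothesis bn1 : forall i, (i < N)%N -> 1 - a * Q / b * Q ^+ i != 0.
Hypothesis cn1 : forall i, (i < N)%N -> 1 - a * Q / c * Q ^+ i != 0.

Local Notation B := (a * Q / (b * c)).

(** Summand of a balanced 3phi2 that terminates at j = k: the product of its lower parameters is Q
    times the product of the upper ones. *)
Definition saal_term k j := P (Q ^- k) j * P (a * Q ^+ k) j * P B j
   / (P Q j * P (a * Q / b) j * P (a * Q / c) j) * Q ^+ j.

Lemma qf_neq0 x j : (forall i, (i < N)%N -> 1 - x * Q ^+ i != 0) -> (j <= N)%N -> P x j != 0.
Proof. by move=> h jN; apply: qfac_neq0 => i ij; apply: h; apply: leq_trans ij jN. Qed.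

(* The right-hand side is the q-Zeilberger certificate of the first-order recurrence in k. *)
Lemma saal_telescope k J : (J <= N)%N ->
  \sum_(j < J.+1) (saal_term k.+1 j * ((1 - a * Q / b * Q ^+ k) * (1 - a * Q / c * Q ^+ k))
            - saal_term k j * ((1 - b * Q ^+ k) * (1 - c * Q ^+ k) * B))
  = (1 - a * Q * Q ^+ k ^+ 2) * (P (Q ^- k) J * P (a * Q * Q ^+ k) J * P B J.+1
      / (P Q J * P (a * Q / b) J * P (a * Q / c) J)).
Proof.
elim: J => [|J IH] JN.
  rewrite big_ord_recl big_ord0 /saal_term !qfacS !qfac0 !expr0.
  by field; rewrite !oner_eq0 !b0 !c0.
rewrite big_ord_recr IH ?(ltnW JN) //=.
have nQ := qf_neq0 Qn1 (ltnW JN). have nb := qf_neq0 bn1 (ltnW JN).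
have nc := qf_neq0 cn1 (ltnW JN).
have := Qn1 JN. have := bn1 JN. have := cn1 JN.
rewrite /saal_term !(qfacS _ _ J.+1).
have -> : P (Q ^- k.+1) J.+1 = (1 - Q ^- k.+1) * P (Q ^- k) J.
  by rewrite qfac_shift; congr (_ * P _ _); rewrite exprS invfM mulrAC mulVf ?mul1r.
have -> : P (a * Q ^+ k) J.+1 = (1 - a * Q ^+ k) * P (a * Q * Q ^+ k) J.
  by rewrite qfac_shift mulrAC.
rewrite (_ : a * Q ^+ k.+1 = a * Q * Q ^+ k) ?exprS ?mulrA // !(qfacS _ _ J).
have x0 : Q ^+ k != 0 by rewrite expf_neq0.
move: (Q ^+ k) x0 (Q ^+ J) nQ nb nc => x x0 y.
move: (P (_ / b) _) => p1. move: (P (_ / c) _) => p2. move: (P Q _) => p3.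
move: (P B _) => p4.  move: (P _ _) => p5. move: (P _ _) => p6.
move=> h1 h2 h3 h4 h5 h6.
field.
by rewrite c0 b0 x0 Q0 h1 h2 h3 h6 (den_neq0 c0 h4) (den_neq0 b0 h5).
Qed.

(** Induction on k by the recurrence above, whose boundary term contains (Q^-k)_N and vanishes for k
    < N. Summing up to N instead of k adds only zeros and gives all k the same range, so that sums
    over j and k can later be exchanged. *)
Lemma saalschutz k : (k <= N)%N ->
  \sum_(j < N.+1) saal_term k j
   = P b k * P c k / (P (a * Q / b) k * P (a * Q / c) k) * B ^+ k.
Proof.
elim: k => [|k IH] kN.
  rewrite big_ord_recl /saal_term !qfac0 big1 => [|i _]; first by rewrite !expr0 addr0 !mulr1 !invr1 !mulr1.
  by rewrite (@qfac_inv_eq0 _ _ Q0 _ 0) // !mul0r.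
have := saal_telescope k (leqnn N).
rewrite (qfac_inv_eq0 Q0 kN) !mul0r mulr0 sumrB -!mulr_suml IH 1?ltnW //.
move/eqP; rewrite subr_eq0 => /eqP.
have := cn1 kN. have := bn1 kN.
have := qf_neq0 bn1 (ltnW kN). have := qf_neq0 cn1 (ltnW kN).
rewrite !(qfacS _ _ k) exprS.
move: (\sum_(_ < _) _) (P b k) (P c k) (P _ _) (P _ _) (B ^+ k) (Q ^+ k).
move=> S p1 p2 p3 p4 u x h1 h2 h3 h4 hS.
apply: (mulIf (mulf_neq0 h3 h4)); rewrite hS; field.
by rewrite b0 c0 h1 h2 (den_neq0 c0 h4) (den_neq0 b0 h3).
Qed.

Hypothesis dn1 : forall i, (i < N)%N -> 1 - a * Q / d * Q ^+ i != 0.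
Hypothesis en1 : forall i, (i < N)%N -> 1 - a * Q / e * Q ^+ i != 0.
Hypothesis fn1 : forall i, (i < N)%N -> 1 - a * Q / f * Q ^+ i != 0.
Hypothesis dn : forall i, (i < N)%N -> 1 - d * Q ^+ i != 0.
Hypothesis en : forall i, (i < N)%N -> 1 - e * Q ^+ i != 0.
Hypothesis fN : f * Q ^+ N = 1.

(** What remains of Watson's summand, apart from 1 - a Q^(2k), when the ratio in b, c and its power
    of [B] are split off. *)
Definition wp k := P a k / P Q k * (P d k * P e k * P f k) /
   (P (a * Q / d) k * P (a * Q / e) k * P (a * Q / f) k) * (a * Q / (d * e * f)) ^+ k.

(* Expanding the factor in b, c of Watson's sum by Saalschütz and exchanging the two
   summations leaves, for each j, a sum of [wterm j k] that no longer involves b, c. *)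
Definition wterm j k := (1 - a * Q ^+ k ^+ 2) * wp k * (P (Q ^- k) j * P (a * Q ^+ k) j).

(** A q-Zeilberger recurrence in j with its certificate on the right; the factor 1 - f Q^K kills the
    certificate at K = N, where f Q^N = 1. *)
Lemma wterm_telescope j K : (K <= N)%N ->
  \sum_(k < K.+1) (wterm j.+1 k * (1 - d * e * f / a * Q ^+ j)
     - wterm j k * ((1 - d * Q ^+ j) * (1 - e * Q ^+ j) * (1 - f * Q ^+ j)))
  = - (Q ^+ j / Q ^+ K * (wp K * (P (Q ^- K) j * P (a * Q ^+ K) j)) * (1 - d * Q ^+ K)
      * (1 - e * Q ^+ K) * (1 - f * Q ^+ K) * (1 - a * Q ^+ K * Q ^+ j)).
Proof.
elim: K => [|K IH] KN.
  rewrite big_ord_recl big_ord0 /wterm /wp !qfac0 !expr0 !qfacS invr1 !mulr1 !divr1.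
  case: j => [|j]; first by rewrite !qfac0 expr0; field; rewrite a0.
  rewrite !(qfac_shift _ 1) ?subrr. ring.
rewrite big_ord_recr IH ?(ltnW KN) //=.
have nQ := qf_neq0 Qn1 (ltnW KN). have nd := qf_neq0 dn1 (ltnW KN).
have ne := qf_neq0 en1 (ltnW KN). have nf := qf_neq0 fn1 (ltnW KN).
have := Qn1 KN. have := dn1 KN. have := en1 KN. have := fn1 KN.
rewrite /wterm /wp.
have x0 : Q ^+ K != 0 by rewrite expf_neq0.
have E1 : P (Q ^- K) j = P (Q ^- K.+1) j * (1 - Q ^+ j / (Q * Q ^+ K)) / (1 - (Q * Q ^+ K)^-1).
  rewrite -exprS [_ / _ ^+ _]mulrC -qfacS qfac_shift.
  have -> : Q ^- K.+1 * Q = Q ^- K by rewrite exprS invfM mulrAC mulVf ?mul1r.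
  rewrite mulrAC mulfV ?mul1r // subr_eq0 eq_sym invr_eq1 exprS.
by move: (Qn1 KN); rewrite subr_eq0 eq_sym.
(* As 1 - a Q^K may vanish, (a Q^K)_j is shifted only together with the boundary factor 1 - a Q^K
   Q^j, without any division. *)
have E2 : P (a * Q ^+ K) j * (1 - a * Q ^+ K * Q ^+ j) = (1 - a * Q ^+ K) * P (a * Q ^+ K.+1) j.
  by rewrite -qfacS qfac_shift exprSr mulrA.
set G := (X in - X + _ = _); have -> : G = Q ^+ j / Q ^+ K * (P a K / P Q K * (P d K * P e K * P f K) /
  (P (a * Q / d) K * P (a * Q / e) K * P (a * Q / f) K) * (a * Q / (d * e * f)) ^+ K)
  * P (Q ^- K) j * ((1 - a * Q ^+ K) * P (a * Q ^+ K.+1) j)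
  * (1 - d * Q ^+ K) * (1 - e * Q ^+ K) * (1 - f * Q ^+ K).
  by rewrite -E2 /G; ring.
clear G E2; rewrite {}E1 !(qfacS _ _ j) !(qfacS _ _ K) !exprS.
move: (P (_ / d) K) nd => p1 nd; move: (P (_ / e) K) ne => p2 ne; move: (P (_ / f) K) nf => p3 nf.
move: (P Q K) nQ => p4 nQ. move: (P d K) (P e K) (P f K) (P a K) => p5 p6 p7 p8.
move: (Q ^+ K) x0 => x x0. move: (_ ^+ K) => z.
move: (P _ j) => p9; move: (P _ j) => p10.
move: (Q ^+ j) => y h1 h2 h3 h4.
field.
rewrite d0 e0 f0 nf ne nd nQ x0 Q0 a0 h4 (den_neq0 f0 h1) (den_neq0 e0 h2) (den_neq0 d0 h3).
by rewrite -opprB oppr_eq0.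
Qed.

Lemma wterm_sum_rec j :
  (\sum_(k < N.+1) wterm j.+1 k) * (1 - d * e * f / a * Q ^+ j) =
  (\sum_(k < N.+1) wterm j k) * ((1 - d * Q ^+ j) * (1 - e * Q ^+ j) * (1 - f * Q ^+ j)).
Proof.
apply/eqP; rewrite -subr_eq0 !mulr_suml -sumrB wterm_telescope //.
by rewrite fN subrr mulr0 mul0r oppr0.
Qed.

(** The starting point of the recursion in j: at j = N the factor (Q^-k)_N leaves only the term k =
    N. *)
Lemma wterm_sum_last : \sum_(k < N.+1) wterm N k =
  (1 - a) * P (a * Q) N / (P (a * Q / d) N * P (a * Q / e) N)
  * (P (Q ^- N) N / P Q N * (a * Q / (d * e * f)) ^+ N) * (P d N * P e N * P f N).
Proof.
rewrite big_ord_recr big1 /=; last first.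
  by move=> k _; rewrite /wterm (qfac_inv_eq0 Q0 (ltn_ord k)) !(mul0r, mulr0).
have f1 : a * Q / f = a * Q * Q ^+ N.
  by apply: (mulIf f0); rewrite divfK // mulrAC -[LHS]mulr1 -fN; ring.
have := qf_neq0 fn1 (leqnn N); rewrite add0r /wterm /wp f1.
have E : (1 - a * Q ^+ N ^+ 2) * P a N * P (a * Q ^+ N) N = (1 - a) * P (a * Q) N * P (a * Q * Q ^+ N) N.
  by rewrite -mulrA -qfacD -mulrA -qfacD -qfac_shift qfacS exprD expr2 mulrA mulrC.
move=> nf; transitivity ((1 - a * Q ^+ N ^+ 2) * P a N * P (a * Q ^+ N) N *
   (P (Q ^- N) N / P Q N * (a * Q / (d * e * f)) ^+ N) * (P d N * P e N * P f N) /
   (P (a * Q / d) N * P (a * Q / e) N * P (a * Q * Q ^+ N) N)).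
  by ring.
have nd := qf_neq0 dn1 (leqnn N). have ne := qf_neq0 en1 (leqnn N).
have nQ := qf_neq0 Qn1 (leqnn N).
rewrite E; field.
by rewrite nQ ne nd nf.
Qed.

(** Descending induction on j, dividing by the factors 1 - d Q^j, 1 - e Q^j and 1 - f Q^j. The case
    j = 0 is the terminating 6phi5 sum; an ascending induction would start from it and divide by 1 -
    (def/a) Q^i. *)
Lemma wterm_sumE j : (j <= N)%N -> \sum_(k < N.+1) wterm j k =
  (1 - a) * P (a * Q) N / (P (a * Q / d) N * P (a * Q / e) N)
  * (P (Q ^- N) N / P Q N * (a * Q / (d * e * f)) ^+ N) *
  ((P d j * P e j * P f j) * \prod_(j <= i < N) (1 - d * e * f / a * Q ^+ i)).
Proof.
move=> jN; rewrite -(subKn jN); move: (N - j)%N (leq_subr j N) => l {j jN}.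
elim: l => [|l IH] lN.
  by rewrite subn0 big_geq // mulr1 wterm_sum_last.
have iN : (N - l.+1 < N)%N by lia.
have := wterm_sum_rec (N - l.+1).
have -> : (N - l.+1).+1 = (N - l)%N by lia.
rewrite IH ?(ltnW lN) //.
rewrite (big_ltn iN).
have -> : (N - l.+1).+1 = (N - l)%N by lia.
have -> : (N - l)%N = (N - l.+1).+1  by lia.
rewrite !(qfacS _ _ (N - l.+1)).
have nf : 1 - f * Q ^+ (N - l.+1) != 0.
  have hl : (l < N)%N by lia.
  have := Qn1 hl; apply: contraNneq => h.
  have h1 : f * Q ^+ (N - l.+1) = 1 by apply/eqP; rewrite eq_sym -subr_eq0 h.
  suff -> : Q * Q ^+ l = 1 by rewrite subrr.
  by rewrite -exprS -[LHS]mul1r -{1}h1 -mulrA -exprD subnK.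
move=> h; apply: (mulIf (mulf_neq0 (mulf_neq0 (dn iN) (en iN)) nf)).
by rewrite -h; ring.
Qed.

(** Watson's transformation multiplied by 1 - a. The quotient (def/a)_N / (def/a)_j of the 4phi3 is
    kept as a product over j <= i < N, so that def/a occurs in no denominator. *)
Lemma watson :
  \sum_(k < N.+1) (1 - a * Q ^+ k ^+ 2) *
    (P a k * P b k * P c k * P d k * P e k * P f k /
     (P Q k * P (a * Q / b) k * P (a * Q / c) k * P (a * Q / d) k * P (a * Q / e) k
      * P (a * Q / f) k) * (a ^+ 2 * Q ^+ 2 / (b * c * d * e * f)) ^+ k)
  = (1 - a) * P (a * Q) N / (P (a * Q / d) N * P (a * Q / e) N)
  * (P (Q ^- N) N / P Q N * (a * Q / (d * e * f)) ^+ N) *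
  \sum_(j < N.+1) P B j / (P Q j * P (a * Q / b) j * P (a * Q / c) j) * Q ^+ j
     * (P d j * P e j * P f j) * \prod_(j <= i < N) (1 - d * e * f / a * Q ^+ i).
Proof.
pose g j := P B j / (P Q j * P (a * Q / b) j * P (a * Q / c) j) * Q ^+ j.
transitivity (\sum_(k < N.+1) \sum_(j < N.+1) g j * wterm j k).
  apply: eq_bigr => k _.
  have kN : (k <= N)%N by rewrite -ltnS.
  transitivity ((1 - a * Q ^+ k ^+ 2) * wp k * \sum_(j < N.+1) saal_term k j).
    rewrite saalschutz // /wp.
    have -> : a ^+ 2 * Q ^+ 2 / (b * c * d * e * f) = B * (a * Q / (d * e * f)).
      by field; rewrite b0 c0 d0 e0 f0.
    rewrite exprMn; field.
    by rewrite !qf_neq0.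
  rewrite mulr_sumr; apply: eq_bigr => j _.
  by rewrite /saal_term /wterm /g; ring.
rewrite exchange_big /= mulr_sumr; apply: eq_bigr => j _.
rewrite -mulr_sumr wterm_sumE -1?ltnS // /g; ring.
Qed.

End Watson.

(** * Congruences in a subring of a field *)

Section Congruence.
Variables (F : fieldType) (O : subringClosed F) (p : F).

Definition unit_in x := [&& x != 0, x \in O & x^-1 \in O].
(** Membership of both sides belongs to the relation; without it congruences could not be
    multiplied. *)
Definition eqm x y := [&& x \in O, y \in O & (x - y) / p \in O].

Lemma unit_in_neq0 x : unit_in x -> x != 0. Proof. by case/and3P. Qed.
Lemma unit_in_mem x : unit_in x -> x \in O. Proof. by case/and3P. Qed.
Lemma unit_in_memV x : unit_in x -> x^-1 \in O. Proof. by case/and3P. Qed.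

Lemma unit_in1 : unit_in 1. Proof. by rewrite /unit_in oner_eq0 invr1 rpred1. Qed.

Lemma unit_inV x : unit_in x -> unit_in x^-1.
Proof. by rewrite /unit_in invr_eq0 invrK => /and3P[-> -> ->]. Qed.

Lemma unit_inM x y : unit_in x -> unit_in y -> unit_in (x * y).
Proof.
case/and3P=> x0 x1 x2 /and3P[y0 y1 y2].
by rewrite /unit_in mulf_neq0 // rpredM //= invfM rpredM.
Qed.

Lemma unit_inN x : unit_in (- x) = unit_in x.
Proof. by rewrite /unit_in oppr_eq0 invrN !rpredN. Qed.

Lemma unit_inX x n : unit_in x -> unit_in (x ^+ n).
Proof. by move=> ux; elim: n => [|n IH]; rewrite ?unit_in1 // exprS unit_inM. Qed.

Lemma unit_in_prod (I : Type) (r : seq I) (P : pred I) (f : I -> F) :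
  (forall i, P i -> unit_in (f i)) -> unit_in (\prod_(i <- r | P i) f i).
Proof. by move=> h; elim/big_ind: _ => // [|x y]; [exact: unit_in1 | exact: unit_inM]. Qed.

Lemma unit_in_qfac Q x k :
  (forall i, (i < k)%N -> unit_in (1 - x * Q ^+ i)) -> unit_in (qfac Q x k).
Proof. by move=> h; apply: unit_in_prod => i _; apply: h. Qed.

Lemma mem_qfac Q x k : Q \in O -> x \in O -> qfac Q x k \in O.
Proof. by move=> QO xO; apply: rpred_prod => i _; rewrite rpredB ?rpred1 // rpredM // rpredX. Qed.

Lemma eqm_l x y : eqm x y -> x \in O. Proof. by case/and3P. Qed.
Lemma eqm_r x y : eqm x y -> y \in O. Proof. by case/and3P. Qed.
Lemma eqm_div x y : eqm x y -> (x - y) / p \in O. Proof. by case/and3P. Qed.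

Lemma eqm_refl x : x \in O -> eqm x x.
Proof. by rewrite /eqm subrr mul0r rpred0 => ->. Qed.

Lemma eqm_sym x y : eqm x y -> eqm y x.
Proof. by case/and3P=> h1 h2 h3; rewrite /eqm h1 h2 -opprB mulNr rpredN. Qed.

Lemma eqm_trans y x z : eqm x y -> eqm y z -> eqm x z.
Proof.
case/and3P=> h1 h2 h3 /and3P[h4 h5 h6]; rewrite /eqm h1 h5.
by rewrite (_ : _ / p = (x - y) / p + (y - z) / p) ?rpredD //; ring.
Qed.

Lemma eqmD x y x' y' : eqm x x' -> eqm y y' -> eqm (x + y) (x' + y').
Proof.
case/and3P=> h1 h2 h3 /and3P[h4 h5 h6]; rewrite /eqm !rpredD //=.
by rewrite (_ : _ / p = (x - x') / p + (y - y') / p) ?rpredD //; ring.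
Qed.

Lemma eqmN x x' : eqm x x' -> eqm (- x) (- x').
Proof. by case/and3P=> h1 h2 h3; rewrite /eqm !rpredN h1 h2 -opprD mulNr rpredN. Qed.

Lemma eqmB x y x' y' : eqm x x' -> eqm y y' -> eqm (x - y) (x' - y').
Proof. by move=> h h'; apply: eqmD => //; apply: eqmN. Qed.

Lemma eqmM x y x' y' : eqm x x' -> eqm y y' -> eqm (x * y) (x' * y').
Proof.
case/and3P=> h1 h2 h3 /and3P[h4 h5 h6]; rewrite /eqm (rpredM h1 h4) (rpredM h2 h5) /=.
rewrite (_ : _ / p = (x - x') / p * y + x' * ((y - y') / p)); last by ring.
exact: rpredD (rpredM h3 h4) (rpredM h2 h6).
Qed.

Lemma eqmX x x' n : eqm x x' -> eqm (x ^+ n) (x' ^+ n).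
Proof.
move=> h; elim: n => [|n IH]; first by rewrite eqm_refl ?rpred1.
by rewrite !exprS eqmM.
Qed.

Lemma eqmV x x' : unit_in x -> unit_in x' -> eqm x x' -> eqm x^-1 x'^-1.
Proof.
case/and3P=> x0 x1 x2 /and3P[y0 y1 y2] /and3P[_ _ h]; rewrite /eqm x2 y2.
suff -> : (x^-1 - x'^-1) / p = - ((x - x') / p * x^-1 * x'^-1).
  by rewrite rpredN (rpredM (rpredM h x2) y2).
suff -> : x^-1 - x'^-1 = - ((x - x') * x^-1 * x'^-1) by ring.
by field; rewrite x0 y0.
Qed.

Lemma eqm_sum (I : Type) (r : seq I) (P : pred I) (f g : I -> F) :
  (forall i, P i -> eqm (f i) (g i)) -> eqm (\sum_(i <- r | P i) f i) (\sum_(i <- r | P i) g i).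
Proof. by move=> h; elim/big_rec2: _ => [|i x y Pi]; [rewrite eqm_refl ?rpred0 | apply/eqmD/h]. Qed.

Lemma eqm_prod (I : Type) (r : seq I) (P : pred I) (f g : I -> F) :
  (forall i, P i -> eqm (f i) (g i)) -> eqm (\prod_(i <- r | P i) f i) (\prod_(i <- r | P i) g i).
Proof. by move=> h; elim/big_rec2: _ => [|i x y Pi]; [rewrite eqm_refl ?rpred1 | apply/eqmM/h]. Qed.

Lemma eqm_qfac Q x y k : Q \in O -> eqm x y -> eqm (qfac Q x k) (qfac Q y k).
Proof.
move=> QO h; apply: eqm_prod => i _; apply: eqmB; first by rewrite eqm_refl ?rpred1.
by apply: eqmM; rewrite ?eqm_refl ?rpredX.
Qed.

Lemma eqm1X x n : eqm x 1 -> eqm (x ^+ n) 1.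
Proof. by move=> /(eqmX n); rewrite expr1n. Qed.

End Congruence.

(** * The well-poised summand and its antisymmetry *)

Section Terms.
Variables (F : fieldType) (Q a c e : F).

(** An upper parameter x a over its well-poised partner a Q/(x a) = Q/x. *)
Definition wpratio x k := qfac Q (x * a) k / qfac Q (Q / x) k.

(* For Q = q^3 and a = q^-1 this is 1 - q times the summand of the theorem. *)
Definition wpterm k := (1 - a * Q ^+ k ^+ 2) * wpratio 1 k ^+ 4 * wpratio c k * wpratio e k
  * (Q ^+ 2 / (c * e * a ^+ 3)) ^+ k.

End Terms.

Section Antisymmetry.
Variables (F : fieldType) (O : subringClosed F) (p : F).
Local Notation "x =~ y" := (eqm O p x y) (at level 70).
Local Notation U := (unit_in O).
Variables (Q a c e : F) (m K : nat).
Hypotheses (uQ : U Q) (ua : U a) (uc : U c) (ue : U e) (u2 : U 2).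
Hypothesis am : a * Q ^+ m =~ 1.
Hypothesis QK : Q ^+ K =~ 1.
Hypothesis unitQ : forall i, (i < m)%N -> U (1 - Q * Q ^+ i).
Hypothesis unitQK : forall i, (i < m)%N -> U (1 - Q * Q ^+ K * Q ^+ i).
Hypothesis unitc : forall i, U (1 - Q / c * Q ^+ i).
Hypothesis unite : forall i, U (1 - Q / e * Q ^+ i).
Hypothesis ratioK : wpratio Q a 1 K \in O.

Let QO := unit_in_mem uQ.
Let aO := unit_in_mem ua.

(** From a Q^m = 1 modulo p, 1 - x a Q^i is congruent to -(x a Q^i)(1 - Q^(m-i)/x): up to monomials,
    the first r numerator factors are the last r factors of (Q/x)_m. *)
Lemma qfac_rev x r : U x -> (r <= m)%N ->
  qfac Q (x * a) r * qfac Q (Q / x) (m - r) =~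
  \prod_(i < r) (- (x * (a * Q ^+ i))) * qfac Q (Q / x) m.
Proof.
move=> ux rm; have xO := unit_in_mem ux; have xVO := unit_in_memV ux.
have x0 := unit_in_neq0 ux.
rewrite -{2}(subnK rm) qfacD mulrCA [X in X =~ _]mulrC; apply: eqmM.
  by rewrite eqm_refl // mem_qfac // rpredM.
have -> : qfac Q (Q / x * Q ^+ (m - r)) r = \prod_(i < r) (1 - Q ^+ (m - i) / x).
  rewrite /qfac (reindex_inj rev_ord_inj); apply: eq_bigr => i _ /=.
  have -> : (m - i = 1 + (m - r) + (r - i.+1))%N by move: (ltn_ord i) rm; clear; lia.
  by rewrite !exprD expr1; ring.
rewrite -big_split /=; apply: eqm_prod => // i _.
rewrite mulNr mulrBr mulr1 opprB.
have -> : x * (a * Q ^+ i) * (Q ^+ (m - i) / x) = a * Q ^+ m.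
  have -> : Q ^+ m = Q ^+ i * Q ^+ (m - i) by rewrite -exprD subnKC // ltnW // (leq_trans (ltn_ord i)).
  by field.
rewrite -mulrA; apply: eqmB; first exact: eqm_sym.
by rewrite eqm_refl // !rpredM ?rpredX.
Qed.

Lemma unit_qfacQ r : (r <= m)%N -> U (qfac Q Q r).
Proof. by move=> rm; apply: unit_in_qfac => i ir; exact: unitQ (leq_trans ir rm). Qed.

(** Apart from monomials, the dependence on r is that of a q-binomial coefficient, symmetric under r
    -> m - r. The value at K stays as an unevaluated constant, since its numerator and denominator
    may both be divisible by p. *)
Lemma eqm_ratio x r : U x -> (r <= m)%N -> wpratio Q a x K \in O ->
  U (qfac Q (Q / x) m) -> U (qfac Q (Q / x) r) -> U (qfac Q (Q / x) (m - r)) ->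
  U (qfac Q (Q / x * Q ^+ K) r) ->
  wpratio Q a x (K + r) =~ wpratio Q a x K * (\prod_(i < r) (- (x * (a * Q ^+ i))) * qfac Q (Q / x) m
     / (qfac Q (Q / x) r * qfac Q (Q / x) (m - r))).
Proof.
move=> ux rm RK um ur umr uKr.
have xO := unit_in_mem ux; have xVO := unit_in_memV ux.
rewrite {1}/wpratio !qfacD invfM mulrACA.
apply: eqmM; first exact: eqm_refl.
have -> : qfac Q (x * a * Q ^+ K) r / qfac Q (Q / x * Q ^+ K) r =
    qfac Q (x * a * Q ^+ K) r * qfac Q (Q / x) (m - r)
      / (qfac Q (Q / x * Q ^+ K) r * qfac Q (Q / x) (m - r)).
  by field; rewrite (unit_in_neq0 uKr) (unit_in_neq0 umr).
apply: eqmM.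
  apply: eqm_trans (qfac_rev ux rm); apply: eqmM; last by rewrite eqm_refl // mem_qfac // rpredM.
  apply: eqm_qfac => //; rewrite -[X in _ =~ X]mulr1; apply: eqmM => //.
  by rewrite eqm_refl // rpredM.
apply: eqmV; rewrite ?unit_inM //; apply: eqmM; last by rewrite eqm_refl // mem_qfac // rpredM.
apply: eqm_qfac => //; rewrite -[X in _ =~ X]mulr1; apply: eqmM => //.
by rewrite eqm_refl // rpredM.
Qed.

Local Notation T := (wpterm Q a c e).

Let v r := a ^+ r * Q ^+ (r ^ 2).

(** The identity (m-r)^2 + m r = r^2 + m(m-r) makes the two sides equal after multiplication by
    powers of a Q^m, which are 1 modulo p. *)
Lemma v_sym r : (r <= m)%N -> v (m - r) =~ v r.
Proof.
move=> rm.
have E : v (m - r) * (a * Q ^+ m) ^+ r = v r * (a * Q ^+ m) ^+ (m - r).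
  rewrite /v !exprMn -!exprM.
  have -> : forall x y z t : F, x * y * (z * t) = (x * z) * (y * t) by move=> *; ring.
  rewrite -!exprD subnK // mulrACA -!exprD subnKC //; congr (_ * _ ^+ _).
  by have [k ->] : exists k, m = (k + r)%N; [exists (m - r)%N; lia | rewrite addnK; lia].
have vO k : v k \in O by rewrite rpredM ?rpredX.
apply: (@eqm_trans _ _ _ (v (m - r) * (a * Q ^+ m) ^+ r)).
  rewrite -[X in X =~ _]mulr1; apply: eqmM; first exact: eqm_refl.
  by apply/eqm_sym/eqm1X.
rewrite E -[X in _ =~ X]mulr1; apply: eqmM; [exact: eqm_refl | exact: eqm1X].
Qed.

Let D r := qfac Q Q r ^+ 4 * qfac Q (Q / c) r * qfac Q (Q / e) r.

Let unit_D r : (r <= m)%N -> U (D r).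
Proof.
by move=> rm; rewrite !unit_inM ?unit_inX ?unit_qfacQ //; apply: unit_in_qfac => i _.
Qed.

Let ratioc_mem x : U x -> (forall i, U (1 - Q / x * Q ^+ i)) -> wpratio Q a x K \in O.
Proof.
move=> ux h; rewrite rpredM ?mem_qfac ?rpredM ?(unit_in_mem ux) //.
by apply: unit_in_memV; apply: unit_in_qfac.
Qed.

Let C := wpratio Q a 1 K ^+ 4 * wpratio Q a c K * wpratio Q a e K
  * (Q ^+ 2 / (c * e * a ^+ 3)) ^+ K * D m.

Let CO : C \in O.
Proof.
rewrite /C rpredM ?(unit_in_mem (unit_D _)) // rpredM //; last first.
  by rewrite rpredX // unit_in_mem // unit_inM ?unit_inX // unit_inV // !unit_inM // unit_inX.
exact: rpredM (rpredM (rpredX 4 ratioK) (ratioc_mem uc unitc)) (ratioc_mem ue unite).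
Qed.

(** The argument Q^2/(c e a^3) is exactly what makes c and e cancel and turns all monomials of the
    summand into a cube. The factor Q^r comes from writing 1 - a Q^(2r) as Q^r (Q^-r - a Q^r). *)
Let mono r : Q ^+ r * (Q ^+ 2 / (c * e * a ^+ 3)) ^+ r *
  ((\prod_(i < r) (- (1 * (a * Q ^+ i)))) ^+ 4 * \prod_(i < r) (- (c * (a * Q ^+ i)))
   * \prod_(i < r) (- (e * (a * Q ^+ i)))) = v r ^+ 3.
Proof.
have c0 := unit_in_neq0 uc. have e0 := unit_in_neq0 ue. have a0 := unit_in_neq0 ua.
elim: r => [|r IH]; first by rewrite /v !big_ord0 exp0n // !(expr0, mulr1, expr1n).
have -> : v r.+1 = v r * (a * (Q * Q ^+ r ^+ 2)).
  rewrite /v exprSr -[in RHS]exprM -exprS mulrACA -exprD; congr (_ * _ ^+ _).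
  by clear; lia.
rewrite [RHS]exprMn -IH !big_ord_recr /= ![_ ^+ r.+1]exprSr.
move: (\prod_(i < r) _) (\prod_(i < r) _) (\prod_(i < r) _) => p1 p2 p3.
move: ((_ / _) ^+ r) => z; move: (Q ^+ r) => y.
by field; rewrite c0 e0 a0.
Qed.

(** Modulo p, the summand is a factor Q^-r - a Q^r, which changes sign under r -> m - r because a
    Q^m = 1, times a factor that is symmetric by [v_sym]. *)
Lemma wpterm_block r : (r <= m)%N ->
  T (K + r) =~ (Q ^- r - a * Q ^+ r) * (C * v r ^+ 3 / (D r * D (m - r))).
Proof.
move=> rm; have mrm : (m - r <= m)%N by exact: leq_subr.
have u1 : U 1 by exact: unit_in1.
have uQ1 k : (k <= m)%N -> U (qfac Q (Q / 1) k) by rewrite divr1; exact: unit_qfacQ.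
have uc' k : U (qfac Q (Q / c) k) by apply: unit_in_qfac => i _.
have ue' k : U (qfac Q (Q / e) k) by apply: unit_in_qfac => i _.
have QKr x : U x -> (forall i, U (1 - Q / x * Q ^+ i)) -> U (qfac Q (Q / x * Q ^+ K) r).
  by move=> ux h; apply: unit_in_qfac => i _; rewrite -[_ * Q ^+ i]mulrA -exprD.
have uQK : U (qfac Q (Q / 1 * Q ^+ K) r).
  by rewrite divr1; apply: unit_in_qfac => i ir; exact: unitQK (leq_trans ir rm).
have h1 := eqm_ratio u1 rm ratioK (uQ1 _ (leqnn m)) (uQ1 _ rm) (uQ1 _ mrm) uQK.
have h2 := eqm_ratio uc rm (ratioc_mem uc unitc) (uc' _) (uc' _) (uc' _) (QKr _ uc unitc).
have h3 := eqm_ratio ue rm (ratioc_mem ue unite) (ue' _) (ue' _) (ue' _) (QKr _ ue unite).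
have h4 : Q ^- (K + r) - a * Q ^+ (K + r) =~ Q ^- r - a * Q ^+ r.
  have E : Q ^+ (K + r) =~ Q ^+ r.
    by rewrite exprD -[X in _ =~ X]mul1r; apply: eqmM => //; rewrite eqm_refl ?rpredX.
  apply: eqmB; first by apply: eqmV => //; apply: unit_inX.
  by apply: eqmM => //; apply: eqm_refl.
pose z := Q ^+ 2 / (c * e * a ^+ 3).
have uz : U z by rewrite unit_inM ?unit_inX // unit_inV // !unit_inM // unit_inX.
have zO := unit_in_mem uz.
have h5 : Q ^+ K * Q ^+ r * (z ^+ K * z ^+ r) =~ Q ^+ r * (z ^+ K * z ^+ r).
  rewrite -mulrA -[X in _ =~ X]mul1r; apply: eqmM => //.
  by rewrite eqm_refl // !rpredM ?rpredX.
have H := eqmM h4 (eqmM h5 (eqmM (eqmM (eqmX 4 h1) h2) h3)).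
have -> : T (K + r) = (Q ^- (K + r) - a * Q ^+ (K + r)) *
    (Q ^+ K * Q ^+ r * (z ^+ K * z ^+ r) * (wpratio Q a 1 (K + r) ^+ 4 * wpratio Q a c (K + r) * wpratio Q a e (K + r))).
  rewrite /wpterm -/z exprD exprD.
  have := expf_neq0 K (unit_in_neq0 uQ); have := expf_neq0 r (unit_in_neq0 uQ).
  move: (Q ^+ r) (Q ^+ K) => y x y0 x0.
  by field; rewrite x0 y0.
set X := (X in X =~ _) in H *; set Y := (X in _ =~ X) in H.
set Z := (X in _ =~ X); suff <- : Y = Z by [].
rewrite /Y /Z -mono /C -/z /D !divr1.
have := unit_in_neq0 (unit_qfacQ rm). have := unit_in_neq0 (unit_qfacQ mrm).
have := unit_in_neq0 (uc' r). have := unit_in_neq0 (uc' (m - r)%N).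
have := unit_in_neq0 (ue' r). have := unit_in_neq0 (ue' (m - r)%N).
move: (Q ^- r - _) => g; move: (Q ^+ r) (z ^+ K) (z ^+ r) => y z1 z2.
do 3! move: (\prod_(i < r) _) => ?.
do 9! move: (qfac _ _ _) => ?.
move: (wpratio _ _ _ _) (wpratio _ _ _ _) (wpratio _ _ _ _) => r1 r2 r3.
move=> n1 n2 n3 n4 n5 n6; field.
by rewrite n1 n2 n3 n4 n5 n6.
Qed.

Lemma wpterm_antisym r : (r <= m)%N -> T (K + (m - r)) =~ - T (K + r).
Proof.
move=> rm; have mrm : (m - r <= m)%N by exact: leq_subr.
apply: eqm_trans (wpterm_block mrm) _.
apply: eqm_trans (eqmN (eqm_sym (wpterm_block rm))).
rewrite subKn // -[X in _ =~ X]mulNr opprB; apply: eqmM => //.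
  have h s : (s <= m)%N -> a * Q ^+ s =~ Q ^- (m - s).
    move=> sm; have uq : U (Q ^+ (m - s)) by exact: unit_inX.
    have -> : a * Q ^+ s = a * Q ^+ m * Q ^- (m - s).
      by rewrite -mulrA; congr (_ * _); rewrite -{1}(subnKC sm) exprD mulfK // (unit_in_neq0 uq).
    rewrite -[X in _ =~ X]mul1r; apply: eqmM => //.
    by apply/eqm_refl/unit_in_memV.
  apply: eqmB; first by exact/eqm_sym/h.
  by have := h _ mrm; rewrite subKn.
apply: eqmM => //; last first.
  rewrite [D r * _]mulrC; apply: eqm_refl; apply: unit_in_memV.
  by apply: unit_inM; apply: unit_D.
by apply: eqmM; [exact: eqm_refl | apply: eqmX => //; exact: v_sym].
Qed.

(** Reversing the sum gives S = -S modulo p, and 2 is a unit. The weight f is xi eta for the fourth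
    power of 1 - u, and 1 for a block modulo Phi_d. *)
Lemma wpterm_sum (f : nat -> F) : (forall r, (r <= m)%N -> f (m - r)%N =~ f r) ->
  (\sum_(r < m.+1) T (K + r) * f r) / p \in O.
Proof.
move=> h; set S := \sum_(_ < _) _.
have H : S =~ - S.
  rewrite {1}/S (reindex_inj rev_ord_inj) -sumrN; apply: eqm_sum => r _ /=.
  have rm : (r <= m)%N by rewrite -ltnS.
  by rewrite subSS -mulNr; apply: eqmM; [exact: wpterm_antisym|exact: h].
have := eqm_div H; rewrite opprK -mulr2n -mulr_natr.
move=> hS; have -> : S / p = S * 2 / p * 2^-1.
  by rewrite [RHS]mulrAC mulfK ?(unit_in_neq0 u2).
by rewrite rpredM // (unit_in_memV u2).
Qed.

End Antisymmetry.

(** * First-order expansion of products *)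

Lemma sum_rev_split (V : zmodType) (h : nat -> V) M k : (k <= M)%N ->
  \sum_(i < k) h (M - i)%N = \sum_(i < M) h i.+1 - \sum_(i < M - k) h i.+1.
Proof.
elim: k => [|k IH] kM; first by rewrite subn0 subrr big_ord0.
rewrite big_ord_recr IH ?(ltnW kM) //= -(subnSK kM) big_ord_recr /=.
by rewrite opprD addrA addrNK.
Qed.

Section FirstOrder.
Variables (F : fieldType) (O : subringClosed F) (p : F).
Local Notation "x =~ y" := (eqm O p x y) (at level 70).

(** The equality is exact and only X is reduced modulo p: used with w = p it gives the product
    modulo p^2, with w = p^2 modulo p^3. *)
Lemma prod_first_order w (t t' : nat -> F) k : w \in O -> w / p \in O ->
  (forall i, (i < k)%N -> t i =~ t' i) ->
  exists2 X, X =~ \sum_(i < k) t' i & \prod_(i < k) (1 + w * t i) = 1 + w * X.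
Proof.
move=> wO wp; elim: k => [|k IH] h.
  by exists 0; rewrite !big_ord0 ?mulr0 ?addr0 // eqm_refl ?rpred0.
have [i ik|X hX E] := IH; first by apply: h; apply: leq_trans ik _.
exists (X + t k + w * (X * t k)); last by rewrite big_ord_recr /= E; ring.
rewrite big_ord_recr /= -[X in _ =~ X]addr0; apply: eqmD.
  by apply: eqmD => //; apply: h.
have XO := eqm_l hX. have tO := eqm_l (h k (ltnSn k)).
rewrite /eqm subr0 rpred0 (_ : _ / p = X * t k * (w / p)); last by ring.
by rewrite (rpredM wO (rpredM XO tO)) (rpredM (rpredM XO tO) wp).
Qed.

End FirstOrder.

(** * The congruence modulo (1 - u)^4 *)

Section Supercongruence.
Variables (F : fieldType) (O : subringClosed F) (Q a c e u : F) (M : nat).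
Let p := 1 - u.
Local Notation "x =~ y" := (eqm O p x y) (at level 70).
Local Notation U := (unit_in O).
Local Notation P := (qfac Q).
Hypotheses (uQ : U Q) (ua : U a) (uc : U c) (ue : U e) (u2 : U 2).
Hypothesis aM : a * Q ^+ M = u.
Hypothesis p0 : p != 0.
Hypothesis UQ : forall i, (i < M)%N -> U (1 - Q * Q ^+ i).
Hypothesis UQu : forall i, (i < M)%N -> U (1 - Q * u * Q ^+ i).
Hypothesis UQVu : forall i, (i < M)%N -> U (1 - Q / u * Q ^+ i).
Hypothesis Ua : forall i, (i < M)%N -> U (1 - a * Q ^+ i).
Hypothesis Uua : forall i, (i < M)%N -> U (1 - u * a * Q ^+ i).
Hypothesis Uc : forall i, U (1 - Q / c * Q ^+ i).
Hypothesis Ue : forall i, U (1 - Q / e * Q ^+ i).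

Local Notation T := (wpterm Q a c e).
Local Notation ratio := (wpratio Q a).

Let uu : U u. Proof. by rewrite -aM unit_inM ?unit_inX. Qed.
Let u0 : u != 0. Proof. exact: unit_in_neq0 uu. Qed.
Let Q0 : Q != 0. Proof. exact: unit_in_neq0 uQ. Qed.
Let a0 : a != 0. Proof. exact: unit_in_neq0 ua. Qed.
Let c0 : c != 0. Proof. exact: unit_in_neq0 uc. Qed.
Let e0 : e != 0. Proof. exact: unit_in_neq0 ue. Qed.
Let uO : u \in O. Proof. exact: unit_in_mem uu. Qed.
Let QO : Q \in O. Proof. exact: unit_in_mem uQ. Qed.
Let aO : a \in O. Proof. exact: unit_in_mem ua. Qed.
Let pO : p \in O. Proof. by rewrite rpredB ?rpred1. Qed.
Let eqmu : u =~ 1.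
Proof. by rewrite /eqm uO rpred1 -opprB mulNr mulfV // rpredN rpred1. Qed.
Let eqmVu : u^-1 =~ 1.
Proof. by rewrite -invr1; apply: eqmV => //; exact: unit_in1. Qed.

Let ww : p ^+ 2 \in O. Proof. by rewrite rpredX. Qed.
Let wp : p ^+ 2 / p \in O. Proof. by rewrite expr2 mulfK. Qed.

Let aQE i : (i <= M)%N -> a * Q ^+ i = u / Q ^+ (M - i).
Proof. by move=> iM; rewrite -aM -{1}(subnKC iM) exprD mulrA mulfK // expf_neq0. Qed.

Let aQeqm i : (i <= M)%N -> a * Q ^+ i =~ Q ^- (M - i).
Proof.
move=> iM; rewrite aQE // -[X in _ =~ X]mul1r; apply: eqmM => //.
by apply: eqm_refl; apply: unit_in_memV; apply: unit_inX.
Qed.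

Let UQX i : (0 < i <= M)%N -> U (1 - Q ^+ i).
Proof. by case: i => // i /= iM; rewrite exprS UQ. Qed.

Let hX i : F := Q ^+ i / (1 - Q ^+ i) ^+ 2.
Let hY i : F := (1 - Q ^+ i)^-1.
Let H (h : nat -> F) k : F := \sum_(i < k) h i.+1.

Let ratioS x k : ratio x k.+1 = ratio x k * ((1 - x * a * Q ^+ k) / (1 - Q / x * Q ^+ k)).
Proof. by rewrite /wpratio !qfacS invfM mulrACA. Qed.

(** The linear terms of u and 1/u cancel. The second-order coefficient is symmetric under k -> M - k
    because a Q^i = Q^-(M-i) modulo p and x/(1-x)^2 is invariant under x -> 1/x. *)
Lemma ratio_pair k : (k <= M)%N -> exists2 X, X =~ H hX k + H hX (M - k) - H hX M &
  ratio u k * ratio u^-1 k = ratio 1 k ^+ 2 * (1 + p ^+ 2 * X).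
Proof.
move=> kM.
(* Here 1 + p^2 t i is the exact i-th factor of the quotient of both sides. *)
pose t i := u^-1 * (Q ^+ i.+1 * (1 - a * Q ^+ i) ^+ 2 - a * Q ^+ i * (1 - Q ^+ i.+1) ^+ 2)
  / ((1 - a * Q ^+ i) ^+ 2 * ((1 - Q ^+ i.+1 * u) * (1 - Q ^+ i.+1 / u))).
have [i ik|X XE EX] := prod_first_order (t := t) (t' := fun i => hX i.+1 - hX (M - i)) (k := k) ww wp.
  have iM : (i < M)%N := leq_trans ik kM.
  have uw : U (1 - Q ^+ i.+1) by rewrite exprS UQ.
  have uw' : U (1 - Q ^+ (M - i)) by apply: UQX; move: iM; clear; lia.
  have uy : U (1 - Q ^- (M - i)).
    rewrite (_ : 1 - _ = - ((1 - Q ^+ (M - i)) / Q ^+ (M - i))); last first.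
      by rewrite mulrBl mul1r mulfV ?opprB // expf_neq0.
    by rewrite unit_inN unit_inM // unit_inV // unit_inX.
  have wO : Q ^+ i.+1 =~ Q ^+ i.+1 by rewrite eqm_refl // rpredX.
  have -> : hX i.+1 - hX (M - i) = 1 * (Q ^+ i.+1 * (1 - Q ^- (M - i)) ^+ 2 - Q ^- (M - i) * (1 - Q ^+ i.+1) ^+ 2)
     / ((1 - Q ^- (M - i)) ^+ 2 * ((1 - Q ^+ i.+1 * 1) * (1 - Q ^+ i.+1 * 1))).
    have := unit_in_neq0 uw. have := unit_in_neq0 uw'. have := expf_neq0 (M - i) Q0.
    rewrite /hX; move: (Q ^+ _) (Q ^+ _) => x y y0 n1 n2.
    by field; rewrite n2 y0 n1 -opprB oppr_eq0 n1.
  have y1 := aQeqm (ltnW iM).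
  have e1 : 1 =~ 1 by apply: eqm_refl; rewrite rpred1.
  apply: eqmM; first by repeat first [exact: eqmVu | exact: y1 | exact: wO | exact: e1 | apply: eqmB | apply: eqmX | apply: eqmM ].
  apply: eqmV.
  - rewrite unit_inM ?unit_inX ?Ua // exprS unit_inM //; first by rewrite mulrAC UQu.
    by rewrite mulrAC UQVu.
  - by rewrite mulr1 !unit_inM ?unit_inX.
  - by repeat first [exact: eqmu | exact: eqmVu | exact: y1 | exact: wO | exact: e1 | apply: eqmB | apply: eqmX | apply: eqmM ].
exists X.
  suff <- : \sum_(i < k) (hX i.+1 - hX (M - i)) = H hX k + H hX (M - k) - H hX M by [].
  by rewrite sumrB sum_rev_split // /H; ring.
rewrite -EX; elim: k kM {X XE EX} => [|k IH] kM.
  by rewrite big_ord0 /wpratio !qfac0 !(divr1, mulr1, expr1n).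
rewrite big_ord_recr /= !ratioS mulrACA IH ?(ltnW kM) // /t (exprS Q).
have := unit_in_neq0 (UQu kM). have := unit_in_neq0 (UQVu kM).
have := unit_in_neq0 (UQ kM). have := unit_in_neq0 (Ua kM).
rewrite /p; move: (ratio 1 k) (Q ^+ k) (\prod_(i < k) _) => r y z n1 n2 n3 n4.
field.
by rewrite u0 n1 n2 oner_eq0 (den_neq0 u0 n3) mulrAC n4.
Qed.

(** The power u^k stems from the argument of [dterm]; with it the first-order coefficient becomes
    symmetric under k -> M - k. *)
Lemma ratio_single k : (k <= M)%N -> exists2 X, X =~ H hY M - H hY (M - k) - H hY k &
  ratio u^-1 k * u ^+ k = ratio 1 k * (1 + p * X).
Proof.
move=> kM.
pose t i := - (1 - a * Q ^+ i * Q ^+ i.+1) / ((1 - a * Q ^+ i) * (1 - Q ^+ i.+1 * u)).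
have pp : p / p \in O by rewrite mulfV // rpred1.
have [i ik|X XE EX] := prod_first_order (t := t) (t' := fun i => hY (M - i) - hY i.+1) (k := k) pO pp.
  have iM : (i < M)%N := leq_trans ik kM.
  have uw : U (1 - Q ^+ i.+1) by rewrite exprS UQ.
  have uw' : U (1 - Q ^+ (M - i)) by apply: UQX; move: iM; clear; lia.
  have uy : U (1 - Q ^- (M - i)).
    rewrite (_ : 1 - _ = - ((1 - Q ^+ (M - i)) / Q ^+ (M - i))); last first.
      by rewrite mulrBl mul1r mulfV ?opprB // expf_neq0.
    by rewrite unit_inN unit_inM // unit_inV // unit_inX.
  have wO : Q ^+ i.+1 =~ Q ^+ i.+1 by rewrite eqm_refl // rpredX.
  have -> : hY (M - i) - hY i.+1 = - (1 - Q ^- (M - i) * Q ^+ i.+1) / ((1 - Q ^- (M - i)) * (1 - Q ^+ i.+1 * 1)).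
    have := unit_in_neq0 uw. have := unit_in_neq0 uw'. have := expf_neq0 (M - i) Q0.
    rewrite /hY; move: (Q ^+ _) (Q ^+ _) => x y y0 n1 n2.
    by field; rewrite n2 y0 n1 -opprB oppr_eq0 n1.
  have y1 := aQeqm (ltnW iM).
  have e1 : 1 =~ 1 by apply: eqm_refl; rewrite rpred1.
  apply: eqmM; first by apply: eqmN; apply: eqmB => //; apply: eqmM.
  apply: eqmV.
  - by rewrite unit_inM ?Ua // exprS mulrAC UQu.
  - by rewrite mulr1 !unit_inM.
  - by apply: eqmM; apply: eqmB => //; apply: eqmM.
exists X.
  suff <- : \sum_(i < k) (hY (M - i) - hY i.+1) = H hY M - H hY (M - k) - H hY k by [].
  by rewrite sumrB sum_rev_split // /H; ring.
rewrite -EX; elim: k kM {X XE EX} => [|k IH] kM.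
  by rewrite big_ord0 /wpratio !qfac0 !(divr1, mulr1, expr1n).
rewrite big_ord_recr /= !ratioS exprSr mulrACA IH ?(ltnW kM) // /t (exprS Q).
have := unit_in_neq0 (UQu kM). have := unit_in_neq0 (UQVu kM).
have := unit_in_neq0 (UQ kM). have := unit_in_neq0 (Ua kM).
rewrite /p; move: (ratio 1 k) (Q ^+ k) (\prod_(i < k) _) => r y z n1 n2 n3 n4.
field.
by rewrite u0 n1 n2 oner_eq0 mulrAC n4.
Qed.

(** Integrality of X suffices, since this coefficient cancels modulo p in [sum_dterm_eval]. *)
Lemma qfac_pair_num k : (k <= M)%N -> exists2 X, X \in O &
  P (u * a) k * P (u^-1 * a) k = P a k ^+ 2 * (1 - p ^+ 2 * X).
Proof.
move=> kM.
pose t i := - (a * Q ^+ i / (u * (1 - a * Q ^+ i) ^+ 2)).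
have [i ik|X XE EX] := prod_first_order (t := t) (t' := t) (k := k) ww wp.
  have iM : (i < M)%N := leq_trans ik kM.
  apply: eqm_refl; rewrite rpredN (rpredM (rpredM aO (rpredX i QO))) //.
  by rewrite unit_in_memV // unit_inM ?unit_inX ?Ua.
exists (- X); first by rewrite rpredN (eqm_l XE).
rewrite mulrN opprK -EX; elim: k kM {X XE EX} => [|k IH] kM.
  by rewrite big_ord0 !qfac0 !(divr1, mulr1, expr1n).
rewrite big_ord_recr /= !qfacS mulrACA IH ?(ltnW kM) // /t.
have := unit_in_neq0 (Ua kM).
rewrite /p; move: (P a k) (Q ^+ k) (\prod_(i < k) _) => r y z n1.
by field; rewrite u0 n1.
Qed.

Definition qzeta2 : F := \sum_(i < M) Q ^+ i.+1 / (1 - Q ^+ i.+1) ^+ 2.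

(** Origin of the correction factor on the right of the theorem: the quotient of the two sides is
    the product of 1 - p^2 Q^i/(u (1 - Q^i)^2). *)
Lemma qfac_pair_den : exists2 X, X =~ qzeta2 &
  P (Q / u) M * P (Q * u) M = P Q M ^+ 2 * (1 - p ^+ 2 * X).
Proof.
pose t i := - (u^-1 * (Q ^+ i.+1 / (1 - Q ^+ i.+1) ^+ 2)).
have [i ik|X XE EX] := prod_first_order (t := t) (t' := fun i => - hX i.+1) (k := M) ww wp.
  apply: eqmN; rewrite -[X in _ =~ X]mul1r; apply: eqmM => //.
  by apply: eqm_refl; rewrite rpredM ?rpredX // unit_in_memV // unit_inX // UQX.
exists (- X); first by rewrite /qzeta2 -[X in _ =~ X]opprK -sumrN; apply: eqmN.
rewrite mulrN opprK -EX; elim: {-2}M (leqnn M) {X XE EX} => [|k IH] kM.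
  by rewrite big_ord0 !qfac0 !(divr1, mulr1, expr1n).
rewrite big_ord_recr /= !qfacS mulrACA IH ?(ltnW kM) // /t (exprS Q).
have := unit_in_neq0 (UQ kM).
rewrite /p; move: (P Q k) (Q ^+ k) (\prod_(i < k) _) => r y z n1.
by field; rewrite u0 n1.
Qed.

(** The part of the 4phi3 summand that stays fixed while x and y move; Q/(c e a) is Watson's a Q/(b
    c) at the parameters c a and e a. *)
Definition balanced_coef j := P (Q / (c * e * a)) j / (P Q j * P (Q / c) j * P (Q / e) j) * Q ^+ j.

(* Three of the parameters a of [wpterm] are moved to x a, y a and a / u = Q^-M. *)
Definition dterm x y k := (1 - a * Q ^+ k ^+ 2) * (ratio 1 k * ratio c k * ratio e k)
  * (ratio x k * ratio y k * ratio u^-1 k) * (Q ^+ 2 / (c * e * a ^+ 3 * (x * y / u))) ^+ k.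

Let kappa : F := P (Q ^- M) M / P Q M * (Q / a ^+ 2) ^+ M.

Lemma dterm_sum x y : x != 0 -> y != 0 ->
  (forall i, (i < M)%N -> 1 - Q / x * Q ^+ i != 0) ->
  (forall i, (i < M)%N -> 1 - Q / y * Q ^+ i != 0) ->
  (forall i, (i < M)%N -> 1 - x * a * Q ^+ i != 0) ->
  (forall i, (i < M)%N -> 1 - y * a * Q ^+ i != 0) ->
  \sum_(k < M.+1) dterm x y k = (1 - a) * P (a * Q) M / (P (Q / x) M * P (Q / y) M)
   * (kappa * (u / (x * y)) ^+ M) *
   \sum_(j < M.+1) balanced_coef j * (P (x * a) j * P (y * a) j * P (u^-1 * a) j)
     * \prod_(j <= i < M) (1 - a ^+ 2 * (x * y / u) * Q ^+ i).
Proof.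
move=> x0 y0 xQ yQ xa ya.
have Ex z : z != 0 -> a * Q / (z * a) = Q / z by move=> z0; field; rewrite z0 a0.
have n0 z : z != 0 -> z * a != 0 by move=> z0; rewrite mulf_neq0.
have uV0 : u^-1 != 0 by rewrite invr_eq0.
have := @watson F Q a (c * a) (e * a) (x * a) (y * a) (u^-1 * a) M Q0 a0 (n0 _ c0) (n0 _ e0) (n0 _ x0) (n0 _ y0) (n0 _ uV0).
rewrite !Ex // invrK => W.
transitivity (\sum_(k < M.+1) (1 - a * Q ^+ k ^+ 2) *
   (P a k * P (c * a) k * P (e * a) k * P (x * a) k * P (y * a) k * P (u^-1 * a) k /
   (P Q k * P (Q / c) k * P (Q / e) k * P (Q / x) k * P (Q / y) k * P (Q * u) k) *
   (a ^+ 2 * Q ^+ 2 / (c * a * (e * a) * (x * a) * (y * a) * (u^-1 * a))) ^+ k)).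
  apply: eq_bigr => k _; rewrite /dterm /wpratio mul1r divr1 invrK.
  have -> : a ^+ 2 * Q ^+ 2 / (c * a * (e * a) * (x * a) * (y * a) * (u^-1 * a)) =
     Q ^+ 2 / (c * e * a ^+ 3 * (x * y / u)) by field; rewrite c0 e0 x0 y0 a0 u0.
  by rewrite !invfM; ring.
rewrite W //.
- rewrite /kappa.
  have -> : a * Q / (x * a * (y * a) * (u^-1 * a)) = Q / a ^+ 2 * (u / (x * y)).
    by field; rewrite x0 y0 a0 u0.
  rewrite exprMn; congr (_ * _ * _); first by rewrite mulrA.
  apply: eq_bigr => j _.
  have -> : a * Q / (c * a * (e * a)) = Q / (c * e * a) by field; rewrite c0 e0 a0.
  have -> : x * a * (y * a) * (u^-1 * a) / a = a ^+ 2 * (x * y / u) by field; rewrite u0 a0.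
  by [].
- by move=> i iM; rewrite (unit_in_neq0 (UQ iM)).
- by move=> i iM; rewrite (unit_in_neq0 (Uc i)).
- by move=> i iM; rewrite (unit_in_neq0 (Ue i)).
- by move=> i iM; rewrite (unit_in_neq0 (UQu iM)).
- by rewrite -mulrA aM mulVf.
Qed.

Let P_flip x w : x * Q ^+ M = w -> P x M = \prod_(i < M) (1 - w / Q ^+ i.+1).
Proof.
move=> <-; rewrite /qfac (reindex_inj rev_ord_inj); apply: eq_bigr => i _ /=.
have -> : Q ^+ M = Q ^+ (M - i.+1) * Q ^+ i.+1 by rewrite -exprD subnK.
by rewrite mulrA mulfK // expf_neq0.
Qed.

(** The factor p appears because (1-a)(aQ)_M = (a)_(M+1) = (a)_M (1-u). Read backwards, (a)_M and
    (Q^-M)_M turn into (Q/u)_M and (Q)_M up to monomials. *)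
Lemma kappaE : (1 - a) * P (a * Q) M * kappa = p * a ^- M * P (Q / u) M.
Proof.
rewrite -qfac_shift qfacS aM -/p /kappa.
have nQ : P Q M != 0 by apply: qfac_neq0 => i iM; exact: unit_in_neq0 (UQ iM).
rewrite (P_flip aM) (@P_flip _ 1) ?mulVf ?expf_neq0 //.
have E k : \prod_(i < k) (1 - u / Q ^+ i.+1) * \prod_(i < k) (1 - 1 / Q ^+ i.+1)
   = P (Q / u) k * P Q k * u ^+ k / Q ^+ (k ^ 2 + k).
  elim: k => [|k IH]; first by rewrite !big_ord0 !qfac0 addn0 exp0n // !(expr0, mulr1, divr1).
  rewrite !big_ord_recr /= mulrACA IH !qfacS (exprS u) (exprS Q).
  have -> : Q ^+ (k.+1 ^ 2 + k.+1) = Q ^+ (k ^ 2 + k) * (Q * Q ^+ k) ^+ 2.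
    by rewrite -exprS -exprM -exprD; congr (_ ^+ _); clear; lia.
  have := expf_neq0 (k ^ 2 + k) Q0; have := expf_neq0 k Q0.
  move: (Q ^+ (_ + _)) (Q ^+ k) (u ^+ k) (P _ _) (P _ _) => y x v p1 p2 x0 y0.
  by field; rewrite u0 Q0 x0 y0.
transitivity (p * (\prod_(i < M) (1 - u / Q ^+ i.+1) * \prod_(i < M) (1 - 1 / Q ^+ i.+1)) / P Q M
   * (Q / a ^+ 2) ^+ M); first by ring.
rewrite E -{2}aM exprD !exprMn exprVn -!exprM -mulnn [(2 * M)%N]mul2n -addnn exprD.
have := expf_neq0 (M * M) Q0; have := expf_neq0 M Q0; have := expf_neq0 M a0.
move: nQ; move: (Q ^+ (M * M)) (Q ^+ M) (a ^+ M) (P _ _) (P _ _) => y x z p1 p2 n1 n2 n3 n4.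
by field; rewrite n1 n2 n3 n4.
Qed.

Lemma balanced_coef_mem j : (j <= M)%N -> balanced_coef j \in O.
Proof.
move=> jM; rewrite /balanced_coef rpredM ?rpredX // rpredM ?mem_qfac //.
  by rewrite rpredM // unit_in_memV // !unit_inM.
apply: unit_in_memV; rewrite !unit_inM //; apply: unit_in_qfac => i ij //.
by apply: UQ; apply: leq_trans ij jM.
Qed.

Let N0 : F := p * a ^- M / P Q M.
Let PA j : F := \prod_(j <= i < M) (1 - a ^+ 2 * Q ^+ i).
Let PB j : F := \prod_(j <= i < M) (1 - a ^+ 2 / u * Q ^+ i).

Let uPQ : U (P Q M). Proof. by apply: unit_in_qfac => i iM; exact: UQ. Qed.
Let uPQu : U (P (Q * u) M). Proof. by apply: unit_in_qfac => i iM; exact: UQu. Qed.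
Let uPQV : U (P (Q / u) M). Proof. by apply: unit_in_qfac => i iM; exact: UQVu. Qed.

Let X1 i : (i < M)%N -> 1 - Q / 1 * Q ^+ i != 0.
Proof. by move=> iM; rewrite divr1 (unit_in_neq0 (UQ iM)). Qed.
Let X2 i : (i < M)%N -> 1 - 1 * a * Q ^+ i != 0.
Proof. by move=> iM; rewrite mul1r (unit_in_neq0 (Ua iM)). Qed.
Let X3 i : (i < M)%N -> 1 - Q / u * Q ^+ i != 0.
Proof. by move=> iM; rewrite (unit_in_neq0 (UQVu iM)). Qed.
Let X4 i : (i < M)%N -> 1 - u * a * Q ^+ i != 0.
Proof. by move=> iM; rewrite (unit_in_neq0 (Uua iM)). Qed.
Let X5 i : (i < M)%N -> 1 - Q / u^-1 * Q ^+ i != 0.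
Proof. by move=> iM; rewrite invrK (unit_in_neq0 (UQu iM)). Qed.
Let X6 i : (i < M)%N -> 1 - u^-1 * a * Q ^+ i != 0.
Proof.
move=> iM; rewrite -mulrA aQE ?(ltnW iM) // mulKf //.
rewrite subr_eq0 eq_sym invr_eq1.
have iM' : (0 < M - i <= M)%N by move: iM; clear; lia.
by have := unit_in_neq0 (UQX iM'); rewrite subr_eq0 eq_sym.
Qed.

(** With x y = u neither a power of u nor the parameter a^2/u survives, so this sum provides the
    main term. The two sums below share u^M and [PB], and their difference is of relative order
    p^2. *)
Lemma dterm_sumA : \sum_(k < M.+1) dterm u 1 k =
  N0 * \sum_(j < M.+1) balanced_coef j * (P (u * a) j * P a j * P (u^-1 * a) j) * PA j.
Proof.
rewrite dterm_sum ?oner_eq0 // mulr1 divff // expr1n mulr1 divr1 mul1r mulr1.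
congr (_ * _).
rewrite [LHS](_ : _ = (1 - a) * P (a * Q) M * kappa / (P (Q / u) M * P Q M)); last by ring.
rewrite kappaE /N0; field.
by rewrite (unit_in_neq0 uPQ) (unit_in_neq0 uPQV) expf_neq0.
Qed.

Lemma dterm_sumB : \sum_(k < M.+1) dterm 1 1 k =
  N0 * (P (Q / u) M / P Q M * u ^+ M) * \sum_(j < M.+1) balanced_coef j * (P a j * P a j * P (u^-1 * a) j) * PB j.
Proof.
rewrite dterm_sum ?oner_eq0 // mulr1 !divr1 mul1r mul1r.
congr (_ * _).
rewrite [LHS](_ : _ = (1 - a) * P (a * Q) M * kappa * u ^+ M / (P Q M * P Q M)); last by ring.
rewrite kappaE /N0; field.
by rewrite (unit_in_neq0 uPQ) expf_neq0.
Qed.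

Lemma dterm_sumC : \sum_(k < M.+1) dterm u u^-1 k =
  N0 * (P Q M / P (Q * u) M * u ^+ M)
  * \sum_(j < M.+1) balanced_coef j * (P (u * a) j * P (u^-1 * a) j * P (u^-1 * a) j) * PB j.
Proof.
rewrite dterm_sum ?invr_eq0 // divff // divr1 mul1r invrK.
congr (_ * _).
rewrite [LHS](_ : _ = (1 - a) * P (a * Q) M * kappa * u ^+ M / (P (Q / u) M * P (Q * u) M)); last by ring.
rewrite kappaE /N0; field.
by rewrite (unit_in_neq0 uPQ) (unit_in_neq0 uPQu) (unit_in_neq0 uPQV) expf_neq0.
Qed.

(** The two changes of parameters multiply T k by 1 + p^2 xi and by 1 + p eta, and [dterm u u^-1]
    carries both factors; hence the combination is p^3 T xi eta, and the antisymmetry of T against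
    the symmetric weight gives the fourth p. *)
Lemma sum_dterm_diff :
  (\sum_(k < M.+1) T k - (\sum_(k < M.+1) dterm u 1 k + \sum_(k < M.+1) dterm 1 1 k
     - \sum_(k < M.+1) dterm u u^-1 k)) / p ^+ 4 \in O.
Proof.
pose xi k := (ratio u k * ratio u^-1 k / ratio 1 k ^+ 2 - 1) / p ^+ 2.
pose eta k := (ratio u^-1 k * u ^+ k / ratio 1 k - 1) / p.
have r1 k : (k <= M)%N -> ratio 1 k != 0.
  move=> kM; rewrite /wpratio mulf_neq0 ?invr_eq0 //; apply: qfac_neq0 => i ik.
    by apply: X2; apply: leq_trans ik kM.
  by apply: X1; apply: leq_trans ik kM.
have xiE k : (k <= M)%N -> xi k =~ H hX k + H hX (M - k) - H hX M.
  move=> kM; have [X hX' E] := ratio_pair kM.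
  suff -> : xi k = X by [].
  by rewrite /xi E; field; rewrite r1 // p0.
have etaE k : (k <= M)%N -> eta k =~ H hY M - H hY (M - k) - H hY k.
  move=> kM; have [X hX' E] := ratio_single kM.
  suff -> : eta k = X by [].
  by rewrite /eta E; field; rewrite r1 // p0.
have sym r : (r <= M)%N -> xi (M - r)%N * eta (M - r)%N =~ xi r * eta r.
  move=> rM; have rM' : (M - r <= M)%N by exact: leq_subr.
  apply: eqm_trans (eqmM (xiE _ rM') (etaE _ rM')) _.
  apply: eqm_trans _ (eqm_sym (eqmM (xiE _ rM) (etaE _ rM))).
  rewrite subKn // [H hX (M - r) + _]addrC [H hY M - H hY r - _]addrAC.
  by apply: eqm_refl; apply: rpredM; [exact: eqm_r (xiE _ rM) | exact: eqm_r (etaE _ rM)].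
have am1 : a * Q ^+ M =~ 1 by rewrite aM.
have Q01 : Q ^+ 0 =~ 1 by rewrite expr0 eqm_refl ?rpred1.
have UQ0 i : (i < M)%N -> U (1 - Q * Q ^+ 0 * Q ^+ i) by rewrite expr0 mulr1; exact: UQ.
have rat0 : wpratio Q a 1 0 \in O by rewrite /wpratio !qfac0 divr1 rpred1.
have := wpterm_sum uQ ua uc ue u2 am1 Q01 UQ UQ0 Uc Ue rat0 sym.
suff -> : \sum_(k < M.+1) T k - (\sum_(k < M.+1) dterm u 1 k + \sum_(k < M.+1) dterm 1 1 k
     - \sum_(k < M.+1) dterm u u^-1 k) = p ^+ 3 * \sum_(r < M.+1) T (0 + r) * (xi r * eta r).
  move: (\sum_(r < M.+1) T (0 + r) * _) => S hS.
  by rewrite [_ / _](_ : _ = S / p) //; field; rewrite p0.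
rewrite mulr_sumr -big_split -!sumrB /=.
apply: eq_bigr => k _; rewrite add0n.
have kM : (k <= M)%N by rewrite -ltnS.
have E1 : ratio u k * ratio u^-1 k = ratio 1 k ^+ 2 * (1 + p ^+ 2 * xi k).
  by rewrite /xi; field; rewrite r1 // p0.
have E2 : ratio u^-1 k * u ^+ k = ratio 1 k * (1 + p * eta k).
  by rewrite /eta; field; rewrite r1 // p0.
have z0 : c * e * a ^+ 3 != 0 by rewrite !mulf_neq0 // expf_neq0.
have -> : dterm u 1 k = T k * (1 + p ^+ 2 * xi k).
  rewrite /dterm /wpterm mulr1 divff // mulr1 [ratio u k * _ * _]mulrAC E1.
  by ring.
have Z x : x != 0 -> (Q ^+ 2 / (c * e * a ^+ 3 * (x / u))) ^+ k = (Q ^+ 2 / (c * e * a ^+ 3)) ^+ k * (u ^+ k / x ^+ k).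
  move=> x0; rewrite -expr_div_n -exprMn; congr (_ ^+ _); field.
  by rewrite c0 e0 a0 x0 u0.
have -> : dterm 1 1 k = T k * (1 + p * eta k).
  rewrite /dterm /wpterm mulr1 Z ?oner_eq0 // expr1n divr1.
  transitivity ((1 - a * Q ^+ k ^+ 2) * (ratio 1 k * ratio c k * ratio e k) *
    (ratio 1 k * ratio 1 k * (ratio u^-1 k * u ^+ k)) * (Q ^+ 2 / (c * e * a ^+ 3)) ^+ k); first by ring.
  by rewrite E2; ring.
have -> : dterm u u^-1 k = T k * (1 + p ^+ 2 * xi k) * (1 + p * eta k).
  rewrite /dterm /wpterm mulfV // Z ?oner_eq0 // expr1n divr1.
  transitivity ((1 - a * Q ^+ k ^+ 2) * (ratio 1 k * ratio c k * ratio e k) *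
    (ratio u k * ratio u^-1 k * (ratio u^-1 k * u ^+ k)) * (Q ^+ 2 / (c * e * a ^+ 3)) ^+ k); first by ring.
  by rewrite E1 E2; ring.
by ring.
Qed.

Lemma sum_dterm_eval :
  (\sum_(k < M.+1) dterm u 1 k + \sum_(k < M.+1) dterm 1 1 k
     - \sum_(k < M.+1) dterm u u^-1 k
   - N0 * (1 - p ^+ 2 * qzeta2) * \sum_(j < M.+1) balanced_coef j * P a j ^+ 3 * PA j) / p ^+ 4 \in O.
Proof.
rewrite dterm_sumA dterm_sumB dterm_sumC.
have [B hB EB] := qfac_pair_den.
have betaO := eqm_r hB.
have UB : U (1 - p ^+ 2 * B).
  have -> : 1 - p ^+ 2 * B = P (Q / u) M * P (Q * u) M / P Q M ^+ 2.
    by rewrite EB [RHS]mulrAC mulfV ?mul1r // expf_neq0 // (unit_in_neq0 uPQ).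
  by rewrite !unit_inM // unit_inV // unit_inX.
have nB := unit_in_neq0 UB.
move: (qzeta2) hB betaO => b hB bO; have BO := eqm_l hB.
pose A j := (1 - P (u * a) j * P (u^-1 * a) j / P a j ^+ 2) / p ^+ 2.
pose L j := u ^+ M * (P (Q / u) M / P Q M) * P (u^-1 * a) j * PB j / (1 - p ^+ 2 * B).
(* Up to the factor p^2, z j collects the first sum minus the target, then the difference of the
   other two sums. Modulo p one has L j = (a)_j [PA j] and B = b, so both parts cancel whatever A j
   is. *)
pose z j := P a j ^+ 3 * PA j * (b - A j) + L j * (A j - B) * P a j ^+ 2.
have Pa0 j : (j <= M)%N -> P a j != 0.
  by move=> jM; apply: qfac_neq0 => i ij; rewrite (unit_in_neq0 (Ua (leq_trans ij jM))).
have aO' : a ^- M / P Q M \in O.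
  by apply: rpredM; apply: unit_in_memV => //; apply: unit_inX.
have pq0 := unit_in_neq0 uPQ; have pqv0 := unit_in_neq0 uPQV.
have Qu : P (Q * u) M = P Q M ^+ 2 * (1 - p ^+ 2 * B) / P (Q / u) M.
  by rewrite -EB [RHS]mulrAC mulfV ?mul1r.
have am0 : a ^+ M != 0 by rewrite expf_neq0.
rewrite [X in X \in _](_ : _ = \sum_(j < M.+1) a ^- M / P Q M * balanced_coef j * (z j / p)); last first.
  rewrite !mulr_sumr -!big_split -!sumrB mulr_suml; apply: eq_bigr => j _ /=.
  have jM : (j <= M)%N by rewrite -ltnS.
  have EA : P (u * a) j * P (u^-1 * a) j = P a j ^+ 2 * (1 - p ^+ 2 * A j).
    by rewrite /A; field; rewrite Pa0 // p0.
  have -> : P (u * a) j * P a j * P (u^-1 * a) j = P a j ^+ 2 * (1 - p ^+ 2 * A j) * P a j.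
    by rewrite -EA; ring.
  rewrite EA Qu /z /L /N0.
  move: (A j) (balanced_coef j) (P a j) (P (u^-1 * a) j) (PA j) (PB j) (u ^+ M) => ? ? ? ? ? ? ?.
  by field; rewrite am0 pq0 pqv0 p0 nB.
apply: rpred_sum => j _; have jM : (j <= M)%N by rewrite -ltnS.
apply: rpredM; first by rewrite rpredM ?balanced_coef_mem.
have AO : A j \in O.
  have [X XO EX] := qfac_pair_num jM.
  suff -> : A j = X by [].
  by rewrite /A EX; field; rewrite Pa0 // p0.
have PaO : P a j \in O by rewrite mem_qfac.
have e1 : 1 =~ 1 by rewrite eqm_refl ?rpred1.
have hPAB : PB j =~ PA j.
  apply: eqm_prod => i _; apply: eqmB => //; apply: eqmM; last by rewrite eqm_refl ?rpredX.
  by rewrite -[X in _ =~ X]mulr1; apply: eqmM => //; rewrite eqm_refl ?rpredX.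
have PAO := eqm_r hPAB.
have hL : L j =~ 1 * 1 * P a j * PA j * 1.
  apply: eqmM; first apply: eqmM => //; first apply: eqmM.
  - apply: eqmM; first exact: eqm1X.
    rewrite -[X in _ =~ X](mulfV pq0); apply: eqmM; last by apply/eqm_refl/unit_in_memV.
    apply: eqm_qfac => //; rewrite -[X in _ =~ X]mulr1; apply: eqmM => //; exact: eqm_refl.
  - apply: eqm_qfac => //; rewrite -[X in _ =~ X]mul1r; apply: eqmM => //; exact: eqm_refl.
  - rewrite -[X in _ =~ X]invr1; apply: eqmV => //; first exact: unit_in1.
    rewrite /eqm (unit_in_mem UB) rpred1 addrC addKr mulNr rpredN.
    rewrite (_ : _ / p = p * B); last by field; rewrite p0.
    exact: rpredM.
rewrite !(mul1r, mulr1) in hL.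
have : z j =~ P a j ^+ 3 * PA j * (b - A j) + P a j * PA j * (A j - b) * P a j ^+ 2.
  have AA := eqm_refl p AO.
  apply: eqmD; first by apply: eqm_refl; rewrite (rpredM (rpredM (rpredX 3 PaO) PAO) (rpredB bO AO)).
  apply: eqmM; last by apply/eqm_refl/rpredX.
  by apply: eqmM => //; apply: eqmB.
by move/eqm_div; rewrite [X in _ - X](_ : _ = 0) ?subr0 //; ring.
Qed.

Theorem sum_wpterm_cong :
  (\sum_(k < M.+1) T k
   - p * a ^- M / P Q M * (1 - p ^+ 2 * qzeta2)
     * \sum_(j < M.+1) balanced_coef j * P a j ^+ 3 * \prod_(j <= i < M) (1 - a ^+ 2 * Q ^+ i)) / p ^+ 4 \in O.
Proof.
by have := rpredD sum_dterm_diff sum_dterm_eval; rewrite -mulrDl addrA addrNK.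
Qed.

End Supercongruence.

(** * Counting residues modulo d *)

Section ResidueCount.
Variable d : nat.

(** Serves to count the factors of a shifted factorial of length k that are divisible by Phi_d. *)
Lemma sum_residue r k : (r < d)%N ->
  (\sum_(i < k) (i %% d == r) = k %/ d + (r < k %% d))%N.
Proof.
move=> rd; have d0 : (0 < d)%N := leq_ltn_trans (leq0n r) rd.
elim: k => [|k IH]; first by rewrite big_ord0 div0n mod0n.
rewrite big_ord_recr /= IH.
have := divn_eq k d; have := ltn_pmod k d0.
move: (k %/ d)%N (k %% d)%N => y x xd ->.
case: (ltngtP x.+1 d) => [xd'| |E].
- rewrite -addnS !divnMDl // !modnMDl !divn_small // !modn_small // !addn0 -addnA ltnS.
  by case: ltngtP.
- by rewrite ltnNge xd.
- have -> : ((y * d + x).+1 = y.+1 * d)%N by rewrite -addnS E mulSn addnC.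
  rewrite mulnK // modnMl ltn0 addn0 -addnA.
  have rx : (r <= x)%N by rewrite -ltnS E.
  by move: rx; clear; case: ltngtP => //= *; lia.
Qed.

Lemma eqn_mod_mul2l b i j : coprime d b -> (b * i == b * j %[mod d]) = (i == j %[mod d]).
Proof.
move=> cb; wlog ij : i j / (i <= j)%N.
  by move=> h; case: (leqP i j) => [|/ltnW] /h //; rewrite eq_sym [in RHS]eq_sym.
rewrite eq_sym [in RHS]eq_sym !eqn_mod_dvd ?leq_mul2l ?ij ?orbT //.
by rewrite -mulnBr Gauss_dvdr.
Qed.

End ResidueCount.

(** * Valuations at Phi_d and vanishing modulo Phi_d *)

Section LocalAtCyclotomic.
Variables (F : fieldType) (O : subringClosed F) (q c e : F) (d : nat).
Local Notation U := (unit_in O).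
Let p := 1 - q ^+ d.
Local Notation "x =~ y" := (eqm O p x y) (at level 70).

(* The facts used about the ring O of fractions whose denominator is coprime to the
   d-th cyclotomic polynomial; there 1 - q^d is a uniformizer. *)
Record cyclo_local : Prop := CycloLocal {
  cl_q : U q; cl_c : U c; cl_e : U e; cl_2 : U 2; cl_p : p != 0;
  cl_unit : forall m, ~~ (d %| m)%N -> U (1 - q ^+ m);
  cl_div : forall m, (0 < m)%N -> (d %| m)%N -> U ((1 - q ^+ m) / p);
  cl_unitc : forall m, U (1 - q ^+ m / c);
  cl_unite : forall m, U (1 - q ^+ m / e) }.

Hypothesis cl : cyclo_local.
Let uq := cl_q cl.
Let q0 : q != 0 := unit_in_neq0 uq.
Let p0 : p != 0 := cl_p cl.
Let pO : p \in O.
Proof. by rewrite rpredB ?rpred1 ?rpredX // (unit_in_mem uq). Qed.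

Definition has_val x v := U (x / p ^+ v).

(** Two natural exponents describe x = q^(m2-m1), so that the powers of q^-1 need no integer
    exponents; m1 != m2 guarantees 1 - x != 0. The valuation is the truth value of the
    congruence. *)
Lemma has_val_1B x m1 m2 : x * q ^+ m1 = q ^+ m2 -> m1 != m2 ->
  has_val (1 - x) (m1 == m2 %[mod d]).
Proof.
have key m : (0 < m)%N -> has_val (1 - q ^+ m) (d %| m)%N.
  move=> m0; rewrite /has_val; case: (boolP (d %| m)%N) => h; first by rewrite expr1 cl_div.
  by rewrite expr0 divr1 cl_unit.
move=> E; rewrite neq_ltn => /orP[] h.
  have -> : x = q ^+ (m2 - m1).
    by apply: (mulIf (expf_neq0 m1 q0)); rewrite E -exprD subnK // ltnW.
  by rewrite eq_sym eqn_mod_dvd ?(ltnW h) // key // subn_gt0.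
have -> : 1 - x = - (1 - q ^+ (m1 - m2)) * q ^- (m1 - m2).
  apply: (mulIf (expf_neq0 m1 q0)); rewrite mulrBl E mul1r.
  have -> : q ^+ m1 = q ^+ (m1 - m2) * q ^+ m2 by rewrite -exprD subnK // ltnW.
  by have := expf_neq0 (m1 - m2) q0; move: (q ^+ (_ - _)) => y y0; field.
rewrite eqn_mod_dvd ?(ltnW h) // /has_val mulrAC unit_inM //; last by rewrite unit_inV // unit_inX.
by rewrite mulNr unit_inN; apply: key; rewrite subn_gt0.
Qed.

Lemma unit_1B x m1 m2 : x * q ^+ m1 = q ^+ m2 -> m1 != m2 %[mod d] -> U (1 - x).
Proof.
move=> E h; have := has_val_1B E; rewrite (negPf h) /has_val expr0 divr1; apply.
by apply: contraNneq h => ->.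
Qed.

Lemma eqm_1 x m1 m2 : x * q ^+ m1 = q ^+ m2 -> m1 = m2 %[mod d] -> x =~ 1.
Proof.
move=> E h.
have xO : x \in O.
  have -> : x = q ^+ m2 / q ^+ m1 by rewrite -E mulfK // expf_neq0.
  by apply: rpredM; rewrite ?rpredX ?(unit_in_mem uq) // unit_in_memV // unit_inX.
have [E'|E'] := eqVneq m1 m2.
  have -> : x = 1 by apply: (mulIf (expf_neq0 m1 q0)); rewrite E E' mul1r.
  by rewrite eqm_refl ?rpred1.
have := has_val_1B E E'; rewrite h eqxx /has_val expr1 => /unit_in_mem h1.
by rewrite /eqm xO rpred1 -opprB mulNr rpredN.
Qed.

Lemma has_val_prod (s : seq nat) (f : nat -> F) (v : nat -> nat) :
  (forall i, has_val (f i) (v i)) -> has_val (\prod_(i <- s) f i) (\sum_(i <- s) v i)%N.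
Proof.
move=> h; elim/big_rec2: _ => [|i x y _ hx]; first by rewrite /has_val expr0 divr1 unit_in1.
by rewrite /has_val exprD -mulf_div unit_inM //; exact: h.
Qed.

Lemma has_valM x y v w : has_val x v -> has_val y w -> has_val (x * y) (v + w).
Proof. by move=> hx hy; rewrite /has_val exprD -mulf_div unit_inM. Qed.

Lemma has_valX x v k : has_val x v -> has_val (x ^+ k) (v * k).
Proof. by move=> hx; rewrite /has_val exprM -expr_div_n unit_inX. Qed.

Lemma has_val_div x y v w k : has_val x v -> has_val y w -> (w + k <= v)%N -> x / y / p ^+ k \in O.
Proof.
move=> hx hy wv; have := unit_in_neq0 hy; rewrite mulf_eq0 negb_or => /andP[y0 _].
have -> : x / y / p ^+ k = (x / p ^+ v) * (y / p ^+ w)^-1 * p ^+ (v - (w + k)).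
  rewrite -{1}(subnK wv) !exprD.
  have := expf_neq0 (v - (w + k)) p0. have := expf_neq0 w p0. have := expf_neq0 k p0.
  move: (_ ^+ _) (_ ^+ _) (_ ^+ _) => a1 a2 a3 n1 n2 n3.
  by field; rewrite n1 n2 n3 y0.
by rewrite rpredM ?rpredX // rpredM ?(unit_in_mem hx) // unit_in_memV.
Qed.

Variables (n M : nat).
Hypotheses (nM : (3 * M = n.+1)%N) (dn : (d %| n)%N) (d1 : (1 < d)%N).

Local Notation Q := (q ^+ 3).
Local Notation a := (q^-1).
Local Notation P := (qfac Q).
Local Notation T := (wpterm Q a c e).
Local Notation m := (M %% d)%N.

Let d_gt0 : (0 < d)%N := ltnW d1.
Let md : (m < d)%N := ltn_pmod M d_gt0.

Let cop3 : coprime d 3.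
Proof.
rewrite coprime_sym prime_coprime //; apply/negP => h3.
have : (3 %| n)%N := dvdn_trans h3 dn.
by move=> h; have : (3 %| n + 1)%N by [rewrite addn1 -nM dvdn_mulr]; rewrite dvdn_addr.
Qed.

(** M inverts 3 modulo d. Hence Phi_d divides 1 - q^-1 Q^i exactly when i = M modulo d, and 1 - q^-2
    Q^i exactly when i = 2M. *)
Let M3 : 3 * M = 1 %[mod d].
Proof. by rewrite nM -addn1 -modnDml (eqP dn). Qed.

Let aQ i : a * Q ^+ i * q ^+ 1 = q ^+ (3 * i).
Proof. by rewrite expr1 -exprM mulrAC mulVf ?mul1r. Qed.

Let a2Q i : a ^+ 2 * Q ^+ i * q ^+ 2 = q ^+ (3 * i).
Proof. by rewrite -exprM mulrAC -exprMn mulVf // expr1n mul1r. Qed.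

Let QQ i : Q * Q ^+ i = q ^+ (3 * i.+1).
Proof. by rewrite -exprS -exprM. Qed.

Let res1 i : (1 == 3 * i %[mod d])%N = (i %% d == m)%N.
Proof. by rewrite -M3 eqn_mod_mul2l // eq_sym. Qed.

Let res2 i : (2 == 3 * i %[mod d])%N = (i %% d == (2 * M) %% d)%N.
Proof.
have -> : (2 %% d = (3 * (2 * M)) %% d)%N by rewrite mulnCA -modnMmr M3 modnMmr.
by rewrite eqn_mod_mul2l // eq_sym.
Qed.

Let res0 i : (0 == 3 * i.+1 %[mod d])%N = (i %% d == d.-1)%N.
Proof.
rewrite -[X in X == _ %[mod _]](muln0 3) eqn_mod_mul2l // mod0n eq_sym.
rewrite -addn1 -modnDml; have := ltn_pmod i d_gt0; move: (i %% d)%N => r rd.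
case: (ltngtP r.+1 d) => [h| |<-]; last by rewrite addn1 modnn !eqxx.
  rewrite modn_small addn1 //; symmetry; apply/eqP => E.
  by move: h; rewrite E prednK // ltnn.
by rewrite ltnNge rd.
Qed.

Local Notation cnt k r := (k %/ d + (r < k %% d))%N.

Lemma has_val_Pa k : has_val (P a k) (cnt k m)%N.
Proof.
rewrite -sum_residue // /qfac -(big_mkord xpredT (fun i => 1 - a * Q ^+ i)).
rewrite -(big_mkord xpredT (fun i => (i %% d == m)%N : nat)).
apply: has_val_prod => i; rewrite -res1; apply: has_val_1B (aQ i) _.
by apply/eqP; clear; lia.
Qed.

Lemma has_val_PQ k : has_val (P Q k) (k %/ d)%N.
Proof.
have -> : (k %/ d = cnt k d.-1)%N.
  by rewrite ltnNge -ltnS prednK // ltn_pmod //= addn0.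
rewrite -sum_residue ?prednK // /qfac -(big_mkord xpredT (fun i => 1 - Q * Q ^+ i)).
rewrite -(big_mkord xpredT (fun i => (i %% d == d.-1)%N : nat)).
apply: has_val_prod => i; rewrite -res0; apply: (@has_val_1B _ 0) => //.
by rewrite expr0 mulr1 QQ.
Qed.

Lemma has_val_Pa2 j : (j <= M)%N -> exists2 v,
  has_val (\prod_(j <= i < M) (1 - a ^+ 2 * Q ^+ i)) v &
  (v + cnt j ((2 * M) %% d) = cnt M ((2 * M) %% d))%N.
Proof.
move=> jM; have m2d : ((2 * M) %% d < d)%N := ltn_pmod (2 * M) d_gt0.
exists (\sum_(j <= i < M) (i %% d == (2 * M) %% d))%N.
  apply: has_val_prod => i; rewrite -res2; apply: has_val_1B (a2Q i) _.
  by apply/eqP; clear; lia.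
rewrite -!sum_residue //.
rewrite -!(big_mkord xpredT (fun i => (i %% d == (2 * M) %% d)%N : nat)) addnC.
by rewrite -big_cat_nat.
Qed.

Let uPx x k : (forall i, U (1 - q ^+ i / x)) -> U (P (Q / x) k).
Proof.
by move=> h; apply: unit_in_qfac => i _; rewrite mulrAC QQ.
Qed.

Let aO : a \in O. Proof. by rewrite unit_in_memV. Qed.
Let QO : Q \in O. Proof. by rewrite rpredX // unit_in_mem. Qed.

Lemma wpratio1_mem k : wpratio Q a 1 k \in O.
Proof.
have := has_val_div (k := 0) (has_val_Pa k) (has_val_PQ k).
by rewrite /wpratio mul1r !divr1; apply; rewrite addn0 leq_addr.
Qed.

(** Past the residue m, (a)_k has one more factor divisible by Phi_d than (Q)_k, and their ratio
    occurs to the fourth power. For d = n this disposes of the terms M < k < n, which is why both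
    upper limits are admissible. *)
Lemma wpterm_vanish k : (m < k %% d)%N -> T k / p ^+ 4 \in O.
Proof.
move=> mk; have := has_val_div (k := 1) (has_val_Pa k) (has_val_PQ k).
rewrite mk leqnn => /(_ isT); rewrite expr1 -[P a k]divr1 => h.
have -> : T k / p ^+ 4 = (1 - a * Q ^+ k ^+ 2) * (P a k / 1 / P Q k / p) ^+ 4
   * wpratio Q a c k * wpratio Q a e k * (Q ^+ 2 / (c * e * a ^+ 3)) ^+ k.
  have := unit_in_neq0 (has_val_PQ k); rewrite mulf_eq0 negb_or => /andP[n1 _].
  rewrite /wpterm [wpratio Q a 1 k]/wpratio !divr1 mul1r.
  move: (wpratio _ _ _ _) (wpratio _ _ _ _) (_ ^+ k) (_ ^+ k) => x1 x2 x3 x4.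
  by field; rewrite n1 p0 q0.
have hr x : U x -> (forall i, U (1 - q ^+ i / x)) -> wpratio Q a x k \in O.
  move=> ux hx; rewrite /wpratio; apply: rpredM; last by apply/unit_in_memV/uPx.
  by apply: mem_qfac => //; rewrite rpredM // unit_in_mem.
apply: rpredM; last first.
  apply: rpredX; apply: unit_in_mem; apply: unit_inM; first by apply: unit_inX; apply: unit_inX.
  by apply: unit_inV; rewrite !unit_inM ?unit_inX ?(cl_c cl) ?(cl_e cl) // unit_inV.
apply: rpredM; last by apply: hr; [exact: cl_e cl|exact: cl_unite cl].
apply: rpredM; last by apply: hr; [exact: cl_c cl|exact: cl_unitc cl].
apply: rpredM; last by apply: rpredX.
by apply: rpredB; [exact: rpred1 | apply: rpredM => //; do 2! apply: rpredX].
Qed.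

Lemma wpterm_vanish1 k : (m < k %% d)%N -> T k / p \in O.
Proof.
move/wpterm_vanish => h; have -> : T k / p = T k / p ^+ 4 * p ^+ 3 by field; rewrite p0.
by rewrite rpredM ?rpredX.
Qed.

Lemma wpterm_block_sum s : (\sum_(r < m.+1) T (s * d + r)) / p \in O.
Proof.
have u3 := unit_inX 3 uq.
have hx x : (forall i, U (1 - q ^+ i / x)) -> forall i, U (1 - Q / x * Q ^+ i).
  by move=> h i; rewrite mulrAC QQ.
have hm i : (i < m)%N -> (3 * i.+1 != 0 %[mod d])%N.
  move=> im; rewrite eq_sym res0 modn_small; last by apply: ltn_trans im md.
  by apply/eqP => E; move: im; rewrite E => /leq_ltn_trans/(_ md); rewrite prednK // ltnn.
have := @wpterm_sum F O p Q a c e m (s * d) u3 (unit_inV uq) (cl_c cl) (cl_e cl) (cl_2 cl) _ _ _ _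
  (hx _ (cl_unitc cl)) (hx _ (cl_unite cl)) (wpratio1_mem _) (fun _ => 1).
rewrite (eq_bigr (fun r : 'I__ => T (s * d + r))) => [|r _]; last by rewrite mulr1.
apply.
- by apply: eqm_1 (aQ _) _; rewrite -modnMmr modn_mod modnMmr M3.
- apply: (@eqm_1 _ 0 (3 * (s * d))); first by rewrite expr0 mulr1 -exprM.
  by rewrite mod0n mulnA modnMl.
- move=> i im; apply: (@unit_1B _ 0 (3 * i.+1)); first by rewrite expr0 mulr1 QQ.
  by rewrite eq_sym hm.
- move=> i im; apply: (@unit_1B _ 0 (3 * i.+1 + 3 * s * d)).
    by rewrite expr0 mulr1 mulrAC QQ -exprM -exprD mulnA.
  by rewrite addnC modnMDl eq_sym hm.
- by move=> r _; rewrite eqm_refl ?rpred1.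
Qed.

(** In each block the residues up to m cancel by antisymmetry, and the later ones vanish one by
    one. *)
Lemma wpterm_full_sum s : (\sum_(k < s * d) T k) / p \in O.
Proof.
elim: s => [|s IH]; first by rewrite big_ord0 mul0r rpred0.
rewrite mulSn addnC big_split_ord /= mulrDl rpredD //.
rewrite -(big_mkord xpredT (fun r => T (s * d + r))) (big_cat_nat (n := m.+1)) //=.
rewrite mulrDl rpredD //; first by rewrite big_mkord wpterm_block_sum.
rewrite mulr_suml big_nat; apply: rpred_sum => r /andP[mr rd].
by apply: wpterm_vanish1; rewrite modnMDl (modn_small rd).
Qed.

Lemma wpterm_sum_mem K : K = M \/ K = (n - 1)%N -> (\sum_(k < K.+1) T k) / p \in O.
Proof.
case=> ->.
  (* The incomplete last block stops exactly at residue m, where its antisymmetric part ends. *)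
  have -> : (M.+1 = M %/ d * d + m.+1)%N by rewrite addnS -divn_eq.
  rewrite big_split_ord /= mulrDl rpredD ?wpterm_full_sum //.
  exact: wpterm_block_sum.
have n0 : (0 < n)%N by move: nM; clear; case: n => //; lia.
have -> : ((n - 1).+1 = n %/ d * d)%N by rewrite subn1 prednK // divnK.
exact: wpterm_full_sum.
Qed.

(* This is 1 - q times the right-hand side of the theorem. *)
Definition wprhs : F := (1 - q ^+ n) * a ^- M / P Q M * (1 - (1 - q ^+ n) ^+ 2 * qzeta2 Q M)
  * \sum_(j < M.+1) balanced_coef Q a c e j * P a j ^+ 3 * \prod_(j <= i < M) (1 - a ^+ 2 * Q ^+ i).

Lemma wprhs_mem : wprhs / p \in O.
Proof.
have n0 : (0 < n)%N by move: nM; clear; case: n => //; lia.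
have un : U ((1 - q ^+ n) / p) by apply: cl_div.
have -> : wprhs / p = (1 - q ^+ n) / p * q ^+ M * (1 - (1 - q ^+ n) ^+ 2 * qzeta2 Q M)
  * \sum_(j < M.+1) (P (Q / (c * e * a)) j / (P (Q / c) j * P (Q / e) j) * Q ^+ j
     * (P a j ^+ 3 * \prod_(j <= i < M) (1 - a ^+ 2 * Q ^+ i) / (P Q j * P Q M) / p ^+ 0)).
  rewrite /wprhs exprVn invrK; move: (qzeta2 _ _) (q ^+ n) => b qn.
  rewrite !mulr_sumr mulr_suml; apply: eq_bigr => j _; rewrite /balanced_coef divr1 !invfM; ring.
apply: rpredM.
  apply: rpredM; first by rewrite rpredM ?(unit_in_mem un) // rpredX // unit_in_mem.
  rewrite rpredB ?rpred1 // /qzeta2 mulr_sumr; apply: rpred_sum => i _.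
  have v1 : has_val (1 - q ^+ n) 1 by rewrite /has_val expr1.
  have v2 : has_val (1 - Q ^+ i.+1) (0 == 3 * i.+1 %[mod d])%N.
    by apply: (@has_val_1B _ 0) => //; rewrite expr0 mulr1 -exprM.
  have := has_val_div (k := 0) v1 v2; rewrite addn0 leq_b1 => /(_ isT); rewrite divr1 => h.
  rewrite mulrCA -expr_div_n; apply: rpredM; first by apply: rpredX.
  exact: rpredX.
apply: rpred_sum => j _; have jM : (j <= M)%N by rewrite -ltnS.
apply: rpredM.
  apply: rpredM; last by apply: rpredX.
  apply: rpredM; last first.
    by apply: unit_in_memV; apply: unit_inM; apply: uPx; [exact: cl_unitc cl|exact: cl_unite cl].
  apply: mem_qfac => //; apply: rpredM => //; apply: unit_in_memV.
  by rewrite !unit_inM ?(cl_c cl) ?(cl_e cl) // unit_inV.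
have [v hv vE] := has_val_Pa2 jM.
apply: has_val_div (has_valM (has_valX 3 (has_val_Pa j)) hv) (has_valM (has_val_PQ j) (has_val_PQ M)) _.
(* With r = j mod d, m = M mod d and s = 2M mod d, the claim reduces to [s < r] <= j/d + 3 [m < r] +
   [s < m], where j/d is the integer quotient and brackets are truth values: if s < r, then m < r or
   s < r <= m. *)
move: vE; case: (ltnP (_ %% d) (j %% d)); case: (ltnP (_ %% d) (j %% d)); case: (ltnP (_ %% d) (M %% d)).

all: move: (j %/ d)%N (M %/ d)%N (M %% d)%N (j %% d)%N ((2 * M) %% d)%N; clear; lia.
Qed.

End LocalAtCyclotomic.

(** * The case d = n *)

Section TopDivisor.
Variables (F : fieldType) (O : subringClosed F) (q c e : F) (n M : nat).
Hypothesis cl : cyclo_local O q c e n.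
Hypotheses (nM : (3 * M = n.+1)%N) (n1 : (1 < n)%N).
Local Notation U := (unit_in O).

Lemma wprhs_cong K : K = M \/ K = (n - 1)%N ->
  (\sum_(k < K.+1) wpterm (q ^+ 3) q^-1 c e k - wprhs q c e n M) / (1 - q ^+ n) ^+ 4 \in O.
Proof.
move=> hK; have uq := cl_q cl; have q0 := unit_in_neq0 uq.
have Mn : (M < n)%N by move: nM n1; clear; lia.
have M0 : (0 < M)%N by move: nM n1; clear; lia.
have -> : \sum_(k < K.+1) wpterm (q ^+ 3) q^-1 c e k - wprhs q c e n M =
   (\sum_(k < M.+1) wpterm (q ^+ 3) q^-1 c e k - wprhs q c e n M)
   + \sum_(M.+1 <= k < K.+1) wpterm (q ^+ 3) q^-1 c e k.
  rewrite addrAC -!(big_mkord xpredT (wpterm (q ^+ 3) q^-1 c e)) -big_cat_nat //.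
  by rewrite ltnS; case: hK => ->; rewrite ?leqnn // -ltnS subn1 prednK // ltnW.
rewrite mulrDl; apply: rpredD; last first.
  rewrite mulr_suml big_nat; apply: rpred_sum => k /andP[Mk kK].
  apply: (wpterm_vanish cl nM (dvdnn n) n1).
  have kn : (k < n)%N.
    by case: hK kK => -> kK; [apply: leq_ltn_trans Mn | rewrite subn1 prednK // ltnW in kK].
  by rewrite !modn_small.
have QQ i : q ^+ 3 * (q ^+ 3) ^+ i = q ^+ (3 * i.+1) by rewrite -exprS -exprM.
have aQ i : q^-1 * (q ^+ 3) ^+ i * q ^+ 1 = q ^+ (3 * i).
  by rewrite expr1 -exprM mulrAC mulVf ?mul1r.
(* As 0 < 3(i+1) <= n+1 < 2n, only 3(i+1) = n could occur, which contradicts 3M = n+1. *)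
have h3 i : (i < M)%N -> ~~ (n %| 3 * i.+1)%N.
  move=> iM; apply/negP => /dvdnP[k E].
  have : (3 * i.+1 <= n.+1)%N by rewrite -nM leq_mul2l.
  rewrite E; case: k E => [|[|k]] E; first by move: E; clear; lia.
    by move=> _; move: E nM; clear; lia.
  by move: n1; clear; rewrite mulSn mulSn; lia.
have h3' i : (i < M)%N -> 0 != 3 * i.+1 %[mod n].
  by move=> iM; rewrite eq_sym eqn_mod_dvd // subn0 h3.
have h1 i : (i < M)%N -> 1 != 3 * i %[mod n].
  move=> iM; have [->|i0] := posnP i; first by rewrite muln0 mod0n modn_small.
  have i3 : (1 < 3 * i)%N by move: i0; clear; lia.
  rewrite eq_sym eqn_mod_dvd ?(ltnW i3) // gtnNdvd ?subn_gt0 //.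
  by move: nM iM; clear; lia.
have aM : q^-1 * (q ^+ 3) ^+ M = q ^+ n.
  by rewrite -exprM nM exprS mulKf.
have hx x : (forall i, U (1 - q ^+ i / x)) -> forall i, U (1 - q ^+ 3 / x * (q ^+ 3) ^+ i).
  by move=> h i; rewrite mulrAC QQ.
apply: (@sum_wpterm_cong _ O (q ^+ 3) q^-1 c e (q ^+ n) M (unit_inX 3 uq) (unit_inV uq)
   (cl_c cl) (cl_e cl) (cl_2 cl) aM (cl_p cl)).
- move=> i iM; apply: (@unit_1B _ _ _ _ _ _ cl _ 0 (3 * i.+1)); last exact: h3'.
  by rewrite expr0 mulr1 QQ.
- move=> i iM; apply: (@unit_1B _ _ _ _ _ _ cl _ 0 (3 * i.+1 + n)).
    by rewrite expr0 mulr1 [q ^+ 3 * q ^+ n * _]mulrAC QQ -exprD.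
  by rewrite modnDr; exact: h3'.
- move=> i iM; apply: (@unit_1B _ _ _ _ _ _ cl _ n (3 * i.+1)).
    by rewrite [q ^+ 3 / q ^+ n * _]mulrAC QQ divfK // expf_neq0.
  by have := h3' i iM; rewrite mod0n modnn.
- by move=> i iM; apply: (@unit_1B _ _ _ _ _ _ cl _ 1 (3 * i)); [exact: aQ|exact: h1].
- move=> i iM; apply: (@unit_1B _ _ _ _ _ _ cl _ 1 (n + 3 * i)).
    by rewrite exprD -(aQ i) !mulrA.
  by rewrite modnDl h1.
- exact: hx (cl_unitc cl).
- exact: hx (cl_unite cl).
Qed.

End TopDivisor.

(** * Localization of K[X] and gluing of congruences *)

Section LocalRing.
Variable K : fieldType.
Local Notation T := (@FracField.tofrac {poly K}).

Definition locring (P : {poly K}) : {pred {fraction {poly K}}} :=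
  [pred x | boolp.asbool (exists N D, [/\ D != 0, coprimep D P & x = T N / T D])].

Lemma locringP P x :
  reflect (exists N D, [/\ D != 0, coprimep D P & x = T N / T D]) (x \in locring P).
Proof. exact: boolp.asboolP. Qed.

Lemma locring_closed P : GRing.subring_closed (locring P).
Proof.
have T0 D : D != 0 -> T D != 0 by rewrite tofrac_eq0.
split.
- by apply/locringP; exists 1, 1; rewrite oner_eq0 coprime1p tofrac1 divr1.
- move=> x y /locringP[N [D [D0 cD ->]]] /locringP[N' [D' [D0' cD' ->]]]; apply/locringP.
  exists (N * D' - N' * D), (D * D'); split; rewrite ?mulf_neq0 // ?coprimepMl ?cD //.
  by rewrite tofracB !tofracM -mulNr addf_div ?T0 // mulNr.
- move=> x y /locringP[N [D [D0 cD ->]]] /locringP[N' [D' [D0' cD' ->]]]; apply/locringP.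
  exists (N * N'), (D * D'); split; rewrite ?mulf_neq0 // ?coprimepMl ?cD //.
  by rewrite !tofracM mulf_div.
Qed.

HB.instance Definition _ P := GRing.isSubringClosed.Build {fraction {poly K}} (locring P) (locring_closed P).

Lemma unit_in_tofrac P D : D != 0 -> coprimep D P -> unit_in (locring P) (T D).
Proof.
move=> D0 cD; rewrite /unit_in tofrac_eq0 D0 /=; apply/andP; split; apply/locringP.
  by exists D, 1; rewrite oner_eq0 coprime1p tofrac1 divr1.
by exists 1, D; rewrite tofrac1 div1r.
Qed.

(* This is the congruence x = 0 mod P of the paper. *)
Definition multiple_of (P : {poly K}) (x : {fraction {poly K}}) :=
  exists N D, [/\ D != 0, coprimep D P & x = T P * T N / T D].

(** The two representations have unrelated denominators. Reducing the first to lowest terms N/D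
    forces P2 | N, and D | D2, so D is coprime to P1 and P2 at once. *)
Lemma multiple_ofM P1 P2 x : coprimep P1 P2 ->
  multiple_of P1 x -> multiple_of P2 x -> multiple_of (P1 * P2) x.
Proof.
move=> c12 [N1 [D1 [D10 cD1 ->]]] [N2 [D2 [D20 cD2 E]]].
have T0 D : D != 0 -> T D != 0 by rewrite tofrac_eq0.
have {}E : P1 * N1 * D2 = P2 * N2 * D1.
  apply/eqP; rewrite -tofrac_eq !tofracM -eqr_div ?T0 //; exact/eqP.
pose g := gcdp N1 D1; pose N := N1 %/ g; pose D := D1 %/ g.
have EN : N * g = N1 by rewrite divpK // dvdp_gcdl.
have ED : D * g = D1 by rewrite divpK // dvdp_gcdr.
have g0 : g != 0 by rewrite gcdp_eq0 negb_and D10 orbT.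
have D0 : D != 0 by move: D10; rewrite -ED mulf_eq0 negb_or => /andP[].
have cND : coprimep N D by rewrite coprimep_div_gcd // D10 orbT.
have {}E : P1 * N * D2 = P2 * N2 * D.
  by apply: (mulIf g0); rewrite mulrAC -[P1 * N * g]mulrA EN E -[RHS]mulrA ED.
have dN : P2 %| N.
  have : P2 %| P1 * N * D2 by rewrite E -mulrA dvdp_mulr.
  by rewrite Gauss_dvdpl 1?coprimep_sym // Gauss_dvdpr // coprimep_sym.
have cDP1 : coprimep D P1.
  by apply: coprimep_dvdr cD1; rewrite -ED dvdp_mulr.
have cDP2 : coprimep D P2.
  have dD : D %| P1 * (N * D2) by rewrite mulrA E dvdp_mull.
  move: dD; rewrite Gauss_dvdpr // Gauss_dvdpr; last by rewrite coprimep_sym.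
  by move=> dD; apply: coprimep_dvdr dD cD2.
exists (N %/ P2), D; split => //; first by rewrite coprimepMr cDP1.
rewrite -EN -{1}ED -{1}(divpK dN) [N %/ P2 * P2]mulrC !tofracM.
by rewrite !mulrA -mulf_div mulfV ?mulr1 // T0.
Qed.

Lemma multiple_of_prod (s : seq nat) (f : nat -> {poly K}) x : uniq s ->
  {in s &, forall i j, i != j -> coprimep (f i) (f j)} ->
  multiple_of 1 x -> (forall i, i \in s -> multiple_of (f i) x) ->
  multiple_of (\prod_(i <- s) f i) x.
Proof.
move=> us hc x1; elim: s us hc => [|i s IH] /= us hc hx; first by rewrite big_nil.
case/andP: us => iNs us; rewrite big_cons; apply: multiple_ofM; last 1 first.
- apply: IH => // [j k js ks|j js]; first by apply: hc; rewrite inE ?js ?ks orbT.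
  by apply: hx; rewrite inE js orbT.
- rewrite big_seq; elim/big_rec: _ => [|j P js cP]; first exact: coprimep1.
  rewrite coprimepMr cP andbT; apply: hc; rewrite ?inE ?eqxx ?js ?orbT //.
  by apply: contraNneq iNs => ->.
- by apply: hx; rewrite inE eqxx.
Qed.

End LocalRing.

(** * Cyclotomic polynomials in characteristic 0 *)

Section Cyclotomic.
Variable K : fieldType.
Hypothesis char0 : forall n, (0 < n)%N -> n%:R != 0 :> K.

Definition Phi (n : nat) : {poly K} := map_poly (fun z : int => z%:~R) 'Phi_n.

Lemma prod_Phi n : (0 < n)%N -> \prod_(d <- divisors n) Phi d = 'X^n - 1.
Proof.
move=> n0; rewrite /Phi -rmorph_prod prod_Cyclotomic // rmorphB rmorph1.
by rewrite /= map_polyXn.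
Qed.

Lemma sep_Xn1 n : (0 < n)%N -> separable_poly ('X^n - 1 : {poly K}).
Proof. by move=> n0; apply: separable_Xn_sub_1; apply: char0. Qed.

Lemma Phi_dvd d n : (0 < n)%N -> (d %| n)%N -> Phi d %| 'X^n - 1.
Proof.
move=> n0 dn; rewrite -prod_Phi // (bigD1_seq d) ?divisors_uniq -?dvdn_divisors //=.
by rewrite dvdp_mulr.
Qed.

Lemma coprimep_Phi n d d' : (0 < n)%N -> (d %| n)%N -> (d' %| n)%N -> d != d' ->
  coprimep (Phi d) (Phi d').
Proof.
move=> n0 dn dn' dd'; have := sep_Xn1 n0.
rewrite -prod_Phi // (bigD1_seq d) ?divisors_uniq -?dvdn_divisors //=.
rewrite separable_mul => /and3P[_ _]; apply: coprimep_dvdl.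
by rewrite -big_filter (big_rem d') /= ?dvdp_mulr // mem_filter eq_sym dd' -dvdn_divisors.
Qed.

Lemma coprimep_Xn1_Phi m d : (0 < d)%N -> ~~ (d %| m)%N -> coprimep ('X^m - 1) (Phi d).
Proof.
move=> d0 dm; have m0 : (0 < m)%N by case: m dm => //; rewrite dvdn0.
rewrite coprimep_sym -prod_Phi // big_seq; elim/big_rec: _ => [|d' P]; first exact: coprimep1.
rewrite -dvdn_divisors // => d'm cP; rewrite coprimepMr cP andbT.
(* Both indices divide d m, so the two polynomials are distinct factors of the separable X^(dm) -
   1. *)
apply: (@coprimep_Phi (d * m)).
- by rewrite muln_gt0 d0.
- exact: dvdn_mulr.
- exact: dvdn_mull.
- by apply: contraNneq dm => ->.
Qed.

Lemma Xn1_neq0 m : (0 < m)%N -> 'X^m - 1 != 0 :> {poly K}.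
Proof. by move=> m0; rewrite monic_neq0 // -[1]/(1%:P) monicXnsubC. Qed.

Lemma coprimep_C (k : K) (P : {poly K}) : k != 0 -> coprimep k%:P P.
Proof. by move=> k0; rewrite -alg_polyC coprimepZl // coprime1p. Qed.

(** At a root z of X^d - 1, k = z^m would give k^d = 1. The Bezout relation factors both parts of
    k^d - 1 = (k^d - X^(md)) + (X^(md) - 1). *)
Lemma coprimep_cXn_Phi (k : K) m d : (0 < d)%N -> k ^+ d != 1 ->
  coprimep (k%:P - 'X^m) (Phi d).
Proof.
move=> d0 kd; rewrite coprimep_sym; apply: coprimep_dvdr (Phi_dvd d0 (dvdnn d)) _.
apply/Bezout_eq1_coprimepP.
have k0 : k ^+ d - 1 != 0 by rewrite subr_eq0.
pose v : {poly K} := \sum_(i < d) k%:P ^+ (d.-1 - i) * ('X^m) ^+ i.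
pose w : {poly K} := \sum_(i < m) ('X^d) ^+ i.
exists ((k ^+ d - 1)^-1 *: w, (k ^+ d - 1)^-1 *: v); rewrite /= -!scalerAl -scalerDr.
have -> : w * ('X^d - 1) + v * (k%:P - 'X^m) = (k ^+ d - 1)%:P.
  rewrite ![_ * (_ - _)]mulrC -subrX1 -subrXX -!exprM mulnC addrC.
  by rewrite addrA subrK -polyC_exp -polyCB.
by rewrite -mul_polyC -polyCM mulVf.
Qed.

Section Instance.
Variables (c e : K) (d : nat).
Hypotheses (c0 : c != 0) (e0 : e != 0).
Hypotheses (cn1 : forall m, (0 < m)%N -> c ^+ m != 1) (en1 : forall m, (0 < m)%N -> e ^+ m != 1).
Hypothesis d0 : (0 < d)%N.
Local Notation T := (@FracField.tofrac {poly K}).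
Local Notation U := (unit_in (locring (Phi d))).

Lemma unit_tofracC k : k != 0 -> U (T k%:P).
Proof. by move=> k0; apply: unit_in_tofrac; rewrite ?polyC_eq0 // coprimep_C. Qed.

Lemma unit_tofrac_cXn k m : k != 0 -> (forall i, (0 < i)%N -> k ^+ i != 1) ->
  U (1 - T 'X ^+ m / T k%:P).
Proof.
move=> k0 kn1; have Uk := unit_tofracC k0.
have -> : 1 - T 'X ^+ m / T k%:P = (T k%:P)^-1 * T (k%:P - 'X^m).
  by rewrite tofracB tofracXn mulrBr mulVf ?(unit_in_neq0 Uk) // mulrC.
apply: unit_inM; first exact: unit_inV.
apply: unit_in_tofrac; last by apply: coprimep_cXn_Phi => //; apply: kn1.
rewrite subr_eq0; apply: contraNneq (kn1 1 isT) => /(congr1 (fun P => P.[1])).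
by rewrite hornerC hornerXn expr1n => ->.
Qed.

Lemma coprimep_XPhi : coprimep 'X (Phi d).
Proof.
rewrite coprimep_sym; apply: coprimep_dvdr (Phi_dvd d0 (dvdnn d)) _.
by rewrite coprimepX rootE !hornerE expr0n gtn_eqF // sub0r oppr_eq0 oner_eq0.
Qed.

Lemma cyclo_local_fraction : cyclo_local (locring (Phi d)) (T 'X) (T c%:P) (T e%:P) d.
Proof.
have E m : 1 - T 'X ^+ m = - T ('X^m - 1) by rewrite tofracB tofracXn tofrac1 opprB.
have p0 : 1 - T 'X ^+ d != 0 by rewrite E oppr_eq0 tofrac_eq0 Xn1_neq0.
split => //.
- by apply: unit_in_tofrac; [rewrite polyX_eq0 | exact: coprimep_XPhi].
- exact: unit_tofracC.
- exact: unit_tofracC.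
- have -> : 2 = T 2%:R%:P by rewrite polyC_natr rmorph_nat.
  by apply: unit_tofracC; apply: char0.
- move=> m dm; rewrite E unit_inN; apply: unit_in_tofrac; last exact: coprimep_Xn1_Phi.
  by apply: Xn1_neq0; case: m dm => //; rewrite dvdn0.
- move=> m m0 /dvdnP[k Ek].
  have Em : 'X^m - 1 = ('X^d - 1) * \sum_(i < k) ('X^d) ^+ i :> {poly K}.
    by rewrite -subrX1 -exprM Ek mulnC.
  have -> : (1 - T 'X ^+ m) / (1 - T 'X ^+ d) = T (\sum_(i < k) ('X^d) ^+ i).
    by apply: (mulIf p0); rewrite divfK // !E mulrN -tofracM Em mulrC.
  apply: unit_in_tofrac.
    by have := Xn1_neq0 m0; rewrite Em mulf_eq0 negb_or => /andP[].
  (* Separability of X^m - 1 makes the cofactor of X^d - 1 coprime to X^d - 1, hence to Phi_d. *)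
  have := sep_Xn1 m0; rewrite Em separable_mul => /and3P[_ _ h].
  by rewrite coprimep_sym; apply: coprimep_dvdr h; exact: Phi_dvd.
- by move=> m; apply: unit_tofrac_cXn.
- by move=> m; apply: unit_tofrac_cXn.
Qed.

End Instance.

Local Notation T := (@FracField.tofrac {poly K}).

(** The cofactor (X^n - 1)/Phi_n, raised to the power k, is absorbed into the numerator. *)
Lemma multiple_of_locring n k x : (0 < n)%N -> x / (1 - T 'X ^+ n) ^+ k \in locring (Phi n) ->
  multiple_of (Phi n ^+ k) x.
Proof.
move=> n0 /locringP[N [D [D0 cD E]]].
have p0 : (1 - T 'X ^+ n) ^+ k != 0.
  by rewrite expf_neq0 // -tofracXn -tofrac1 -tofracB tofrac_eq0 -opprB oppr_eq0 Xn1_neq0.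
have ER := divpK (Phi_dvd n0 (dvdnn n)); set R := _ %/ _ in ER.
exists ((- R) ^+ k * N), D; split => //; first exact: coprimep_expr.
rewrite -tofracM mulrA -exprMn mulrN [_ * R]mulrC ER opprB tofracM tofracXn tofracB tofrac1 tofracXn.
by rewrite -mulrA -E mulrC divfK.
Qed.

Definition qsum (n : nat) : {poly K} := \sum_(i < n) 'X ^+ i.

Lemma qsum_prod n : (0 < n)%N -> qsum n = \prod_(d <- divisors n | d != 1%N) Phi d.
Proof.
move=> n0; apply: (mulfI (Xn1_neq0 (ltn0Sn 0))).
rewrite expr1 /qsum -subrX1 -prod_Phi // (bigD1_seq 1%N) ?divisors_uniq -?dvdn_divisors //=.
congr (_ * _); rewrite -['X - 1](_ : 'X^1 - 1 = _) // -prod_Phi // /divisors /=.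
by rewrite big_seq1.
Qed.

Section Divisibility.
Variables (c e : K) (n M K0 : nat).
Hypotheses (c0 : c != 0) (e0 : e != 0).
Hypotheses (cn1 : forall m, (0 < m)%N -> c ^+ m != 1) (en1 : forall m, (0 < m)%N -> e ^+ m != 1).
Hypotheses (nM : (3 * M = n.+1)%N) (n1 : (1 < n)%N) (hK : K0 = M \/ K0 = (n - 1)%N).
Local Notation q := (T 'X).

Lemma multiple_of_qsum_Phi :
  multiple_of (qsum n * Phi n ^+ 3)
   ((\sum_(k < K0.+1) wpterm (q ^+ 3) q^-1 (T c%:P) (T e%:P) k - wprhs q (T c%:P) (T e%:P) n M) / (1 - q)).
Proof.
have n0 := ltnW n1.
set x := _ / _.
(* Phi_1 does not divide [n], so dividing by 1 - q is harmless at every d that occurs. *)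
have u1 d : (1 < d)%N -> (1 - q)^-1 \in locring (Phi d).
  move=> d1; have := cyclo_local_fraction c0 e0 cn1 en1 (ltnW d1).
  move/cl_unit => /(_ 1%N); rewrite dvdn1 expr1 gtn_eqF // => /(_ isT).
  exact: unit_in_memV.
have hn : multiple_of (Phi n ^+ 4) x.
  apply: multiple_of_locring => //; rewrite /x mulrAC; apply: rpredM; last exact: u1.
  exact: wprhs_cong (cyclo_local_fraction c0 e0 cn1 en1 n0) nM n1 K0 hK.
have hd d : (d %| n)%N -> d != 1%N -> multiple_of (Phi d) x.
  move=> dn d1; have d0 := dvdn_gt0 n0 dn.
  have {}d1 : (1 < d)%N by rewrite ltn_neqAle eq_sym d1.
  rewrite -[Phi d]expr1; apply: multiple_of_locring => //; rewrite expr1 /x mulrAC.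
  apply: rpredM; last exact: u1.
  have cl := cyclo_local_fraction c0 e0 cn1 en1 d0.
  rewrite mulrBl; apply: rpredB; first exact: (wpterm_sum_mem cl nM dn d1 hK).
  exact: (wprhs_mem cl nM dn d1).
(* The factor Phi_n of [n] merges with Phi_n^3, which makes the moduli pairwise coprime. *)
pose f d := if d == n then Phi n ^+ 4 else Phi d.
have -> : qsum n * Phi n ^+ 3 = \prod_(d <- [seq d <- divisors n | d != 1%N]) f d.
  have nin : n \in [seq d <- divisors n | d != 1%N].
    by rewrite mem_filter -dvdn_divisors // dvdnn gtn_eqF.
  have us : uniq [seq d <- divisors n | d != 1%N] by rewrite filter_uniq ?divisors_uniq.
  rewrite qsum_prod // -big_filter !(bigD1_seq n nin us) /= /f eqxx mulrAC -exprS.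
  by congr (_ * _); apply: eq_bigr => d /negPf ->.
apply: multiple_of_prod.
- by rewrite filter_uniq ?divisors_uniq.
- move=> i j; rewrite !mem_filter -!dvdn_divisors // => /andP[_ hi] /andP[_ hj] ij.
  have cij := coprimep_Phi n0 hi hj ij; rewrite /f.
  case: eqP => [Ei|_]; case: eqP => [Ej|_] //.
  - by rewrite Ei Ej eqxx in ij.
  - by apply: coprimep_expl; rewrite -Ei.
  - by apply: coprimep_expr; rewrite -Ej.
- have [N [D [D0 cD E]]] := hn.
  by exists (Phi n ^+ 4 * N), D; split; rewrite ?coprimep1 // tofrac1 mul1r tofracM.
- move=> d; rewrite mem_filter -dvdn_divisors // => /andP[d1 dn]; rewrite /f.
  by case: eqP => _ //; apply: hd.
Qed.

End Divisibility.

End Cyclotomic.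

(** * Translation into the notation of the statement *)

Section StatementTerms.
Variables (F : fieldType) (q c e : F) (n M : nat).
Hypotheses (q0 : q != 0) (c0 : c != 0) (e0 : e != 0).
Hypothesis qn1 : forall m, (0 < m)%N -> 1 - q ^+ m != 0.
Local Notation Q := (q ^+ 3).
Local Notation P := (qfac Q).
Let int_ (m : int) : F := (1 - q ^ m) / (1 - q).

Let q1 : 1 - q != 0. Proof. by have := qn1 (ltn0Sn 0). Qed.

Lemma wptermE k :
  int_ (6 * k%:Z - 1) * (P q^-1 k ^+ 4 * P (c * q^-1) k * P (e * q^-1) k)
    / (P Q k ^+ 4 * P (Q / c) k * P (Q / e) k) * (q ^+ 9 / (c * e)) ^+ k
  = wpterm Q q^-1 c e k / (1 - q).
Proof.
have -> : int_ (6 * k%:Z - 1) = (1 - q^-1 * Q ^+ k ^+ 2) / (1 - q).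
  congr ((1 - _) / _).
  rewrite expfzDr // -PoszM -exprnP exprN1 mulrC -!exprM; congr (_ * _ ^+ _).
  by clear; lia.
have -> : q ^+ 9 / (c * e) = Q ^+ 2 / (c * e * q^-1 ^+ 3) by field; rewrite c0 e0 q0.
rewrite /wpterm /wpratio mul1r divr1 !invfM.
move: (_ ^+ k) (Q ^+ k) (P _ _)^-1 (P _ _)^-1 (P _ _)^-1 (1 - q)^-1 => *; ring.
Qed.

(** The product over k <= i < M in [wprhs] becomes (q^-2)_M/(q^-2)_k again, which is legitimate
    since the exponent 3i - 2 is never 0. The factors (1-q)^2 from [3i]^-2 cancel those of [n]^2. *)
Lemma wprhsE :
  int_ n%:Z * q ^+ M * (P (q ^- 2) M / P Q M)
   * (1 - int_ n%:Z ^+ 2 * \sum_(1 <= i < M.+1) q ^+ (3 * i) / int_ (3 * i)%:Z ^+ 2)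
   * \sum_(k < M.+1)
       (P (q ^+ 4 / (c * e)) k * P q^-1 k ^+ 3)
       / (P (Q / c) k * P (Q / e) k * P Q k * P (q ^- 2) k) * q ^+ (3 * k)
  = wprhs q c e n M / (1 - q).
Proof.
have a2n0 k : P (q ^- 2) k != 0.
  apply: qfac_neq0 => i _; case: i => [|i].
    have := qn1 (ltn0Sn 1); rewrite expr0 mulr1 !subr_eq0.
    by rewrite [1 == q ^+ 2]eq_sym [1 == q ^- 2]eq_sym invr_eq1.
  have -> : q ^- 2 * Q ^+ i.+1 = q ^+ (3 * i).+1.
    rewrite -exprM (_ : 3 * i.+1 = 2 + (3 * i).+1)%N; last by clear; lia.
    by rewrite exprD mulKf // expf_neq0.
  exact: qn1.
have -> : \sum_(1 <= i < M.+1) q ^+ (3 * i) / int_ (3 * i)%:Z ^+ 2 = (1 - q) ^+ 2 * qzeta2 Q M.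
  rewrite big_add1 big_mkord /qzeta2 mulr_sumr; apply: eq_bigr => i _.
  rewrite /int_ -exprnP exprM; have := qn1 (m := (3 * i.+1)%N); rewrite muln_gt0 /= => /(_ isT).
  by rewrite exprM; move: (Q ^+ i.+1) => y y1; field; rewrite y1 q1.
have -> : int_ n%:Z = (1 - q ^+ n) / (1 - q) by [].
rewrite /wprhs exprVn invrK; move: (qzeta2 _ _) (q ^+ n) => b qn.
rewrite expr_div_n -[_ / _ * (_ ^+ 2 * b)]mulrA mulKf ?expf_neq0 //.
rewrite !mulr_sumr mulr_suml; apply: eq_bigr => k _.
have kM : (k <= M)%N by rewrite -ltnS.
have -> : P (q ^- 2) M = P (q ^- 2) k * \prod_(k <= i < M) (1 - q^-1 ^+ 2 * Q ^+ i).
  rewrite /qfac -!(big_mkord xpredT (fun i => 1 - q ^- 2 * Q ^+ i)) exprVn.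
  by rewrite -big_cat_nat.
have -> : q ^+ 4 / (c * e) = Q / (c * e * q^-1) by field; rewrite c0 e0 q0.
rewrite /balanced_coef exprM; have := a2n0 k; move: (P (q ^- 2) k) => y y0.
transitivity ((y / y) * ((1 - qn) / (1 - q) * q ^+ M * (\prod_(k <= i < M) (1 - q^-1 ^+ 2 * Q ^+ i) / P Q M)
   * (1 - (1 - qn) ^+ 2 * b) * (P (Q / (c * e * q^-1)) k * P q^-1 k ^+ 3 / (P (Q / c) k * P (Q / e) k * P Q k) * Q ^+ k))).
  by rewrite !invfM; ring.
by rewrite divff // mul1r !invfM; ring.
Qed.

Lemma wp_diffE K :
  \sum_(k < K.+1)
    int_ (6 * k%:Z - 1) * (P q^-1 k ^+ 4 * P (c * q^-1) k * P (e * q^-1) k)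
      / (P Q k ^+ 4 * P (Q / c) k * P (Q / e) k) * (q ^+ 9 / (c * e)) ^+ k
  - int_ n%:Z * q ^+ M * (P (q ^- 2) M / P Q M)
   * (1 - int_ n%:Z ^+ 2 * \sum_(1 <= i < M.+1) q ^+ (3 * i) / int_ (3 * i)%:Z ^+ 2)
   * \sum_(k < M.+1)
       (P (q ^+ 4 / (c * e)) k * P q^-1 k ^+ 3)
       / (P (Q / c) k * P (Q / e) k * P Q k * P (q ^- 2) k) * q ^+ (3 * k)
  = (\sum_(k < K.+1) wpterm Q q^-1 c e k - wprhs q c e n M) / (1 - q).
Proof.
by rewrite wprhsE mulrBl mulr_suml; congr (_ - _); apply: eq_bigr => k _; exact: wptermE.
Qed.

End StatementTerms.

(** * The ground field of rational functions in c and e *)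

Lemma Kce_char0 n : (0 < n)%N -> n%:R != 0 :> Kce.
Proof.
move=> n0; have -> : n%:R = toK n%:R%:P%:P by rewrite !polyC_natr /toK rmorph_nat.
by rewrite tofrac_eq0 !polyC_eq0 pnatr_eq0 -lt0n.
Qed.

Lemma toK_X_neq0 : toK 'X != 0.
Proof. by rewrite tofrac_eq0 polyX_eq0. Qed.

Lemma toK_XC_neq0 : toK ('X : {poly rat})%:P != 0.
Proof. by rewrite tofrac_eq0 polyC_eq0 polyX_eq0. Qed.

Lemma Xn_neq1 (R : nzRingType) m : (0 < m)%N -> 'X^m != 1 :> {poly R}.
Proof.
move=> m0; apply/eqP => /(congr1 (fun P : {poly R} => size P)).
by rewrite size_polyXn size_poly1 => -[E]; rewrite E in m0.
Qed.

Lemma toK_X_exp_neq1 m : (0 < m)%N -> toK 'X ^+ m != 1.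
Proof. by move=> m0; rewrite -tofracXn -tofrac1 tofrac_eq Xn_neq1. Qed.

Lemma toK_XC_exp_neq1 m : (0 < m)%N -> toK ('X : {poly rat})%:P ^+ m != 1.
Proof. by move=> m0; rewrite -tofracXn -tofrac1 tofrac_eq -polyC_exp -polyC1 (inj_eq (@polyC_inj _)) Xn_neq1. Qed.

Lemma q_neq0 : q != 0.
Proof. by rewrite tofrac_eq0 polyX_eq0. Qed.

Lemma cc_neq0 : cc != 0.
Proof. by rewrite tofrac_eq0 polyC_eq0 toK_X_neq0. Qed.

Lemma ee_neq0 : ee != 0.
Proof. by rewrite tofrac_eq0 polyC_eq0 toK_XC_neq0. Qed.

Lemma subr1_qn_neq0 m : (0 < m)%N -> 1 - q ^+ m != 0.
Proof. by move=> m0; rewrite subr_eq0 eq_sym -tofracXn -tofrac1 tofrac_eq Xn_neq1. Qed.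

Theorem theorem2p1 (n M : nat) :
  (0 < n)%N -> (n %% 3 = 2)%N ->
  (M = ((n + 1) %/ 3)%N \/ M = (n - 1)%N) ->
  eqmodq
    (\sum_(k < M.+1)
       qint (6 * (k : nat)%:Z - 1)
       * (qpoch (q^-1) (q ^+ 3) k ^+ 4
          * qpoch (cc * q^-1) (q ^+ 3) k * qpoch (ee * q^-1) (q ^+ 3) k)
       / (qpoch (q ^+ 3) (q ^+ 3) k ^+ 4
          * qpoch (q ^+ 3 / cc) (q ^+ 3) k * qpoch (q ^+ 3 / ee) (q ^+ 3) k)
       * (q ^+ 9 / (cc * ee)) ^+ k)
    (qint n%:Z * q ^+ ((n + 1) %/ 3)
       * (qpoch (q ^- 2) (q ^+ 3) ((n + 1) %/ 3)
          / qpoch (q ^+ 3) (q ^+ 3) ((n + 1) %/ 3))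
       * (1 - qint n%:Z ^+ 2 * \sum_(1 <= i < ((n + 1) %/ 3).+1)
                              q ^+ (3 * i) / qint (3 * i)%:Z ^+ 2)
       * \sum_(k < ((n + 1) %/ 3).+1)
           (qpoch (q ^+ 4 / (cc * ee)) (q ^+ 3) k * qpoch (q^-1) (q ^+ 3) k ^+ 3)
           / (qpoch (q ^+ 3 / cc) (q ^+ 3) k * qpoch (q ^+ 3 / ee) (q ^+ 3) k
              * qpoch (q ^+ 3) (q ^+ 3) k * qpoch (q ^- 2) (q ^+ 3) k)
           * q ^+ (3 * k))
    (qintP n * PhiP n ^+ 3).
Proof.
move=> n0 n3 hM; set N := ((n + 1) %/ 3)%N in hM *.
have nN : (3 * N = n.+1)%N by move: n3; rewrite /N; clear; lia.
have n1 : (1 < n)%N by move: n3 n0; clear; lia.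
have [F [G [G0 cG E]]] := multiple_of_qsum_Phi Kce_char0 toK_X_neq0 toK_XC_neq0
  toK_X_exp_neq1 toK_XC_exp_neq1 nN n1 hM.
exists F, G; split=> //; split=> //.
(* [qpoch], [qint], [qintP] and [PhiP] agree with their counterparts over a general field by
   conversion. *)
exact: etrans (wp_diffE n N q_neq0 cc_neq0 ee_neq0 subr1_qn_neq0 M) E.
Qed.
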